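(* Let $d\ge 2$ be an integer, let $r\in\mathbb{N}$ be an even number, and let $B$ be a positive number. There exists a constant $C(r,B,d)>0$, depending only on $r,B,d$, such that for every $m\in\mathbb{N}$ $$ \tilde D_m^{r,B}\ge C(r,B,d)\,m^{-r}(\log m)^{d-1}. $$
   Context: **Hat functions.** For $u>0$ let $h^1(x,u):=\chi_{[-u/2,u/2)}(x)$ (characteristic function of the interval, $x\in\mathbb{R}$), and inductively $h^r(\cdot,u):=h^{r-1}(\cdot,u)*h^1(\cdot,u)$ for $r\ge2$, where $(f*g)(x)=\int_{\mathbb{R}}f(x-y)g(y)\,dy$. In particular $h^2(x,u)=\max(u-|x|,0)$. For $\mathbf x,\mathbf z\in\mathbb{R}^d$ and $\mathbf u\in(0,\infty)^d$ let $h^r(\mathbf x,\mathbf z,\mathbf u):=\prod_{j=1}^d h^r(x_j-z_j,u_j)$. Its periodization in $\mathbf x$ is $\tilde h^r(\mathbf x,\mathbf z,\mathbf u):=\sum_{\mathbf m\in\mathbb{Z}^d}h^r(\mathbf m+\mathbf x,\mathbf z,\mathbf u)$. **Class of cubature formulas.** For $B>0$ and $m\in\mathbb{N}$, $Q(B,m)$ is the set of all cubature formulas $$\Lambda_m(f,\xi):=\sum_{\mu=1}^m\lambda_\mu f(\xi^\mu),\qquad \xi=\{\xi^\mu\}_{\mu=1}^m\subset[0,1)^d,\quad \lambda_\mu\in\mathbb{R},\ \mu=1,\dots,m,$$ satisfying $\sum_{\mu=1}^m|\lambda_\mu|\le B$. **The quantity $\tilde D_m^{r,B}$.** $$\tilde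 D_m^{r,B}:=\inf_{\Lambda_m(\cdot,\xi)\in Q(B,m)}\ \sup_{\mathbf z\in[0,1)^d,\ \mathbf u\in(0,1/2]^d}\left|\int_{[0,1)^d}\tilde h^r(\mathbf x,\mathbf z,\mathbf u)\,d\mathbf x-\Lambda_m\big(\tilde h^r(\cdot,\mathbf z,\mathbf u),\xi\big)\right|.$$ *)

(* Defs.v *)
From HB Require Import structures.
From mathcomp Require Import all_boot all_order all_algebra.
From mathcomp Require Import all_classical all_reals all_analysis.

Set Implicit Arguments.
Unset Strict Implicit.
Unset Printing Implicit Defensive.

Import Order.TTheory GRing.Theory Num.Theory.
Import numFieldNormedType.Exports.

Local Open Scope classical_set_scope.
Local Open Scope ring_scope.

(* Points of R^d are d-tuples, which the library equips with the product
   sigma-algebra but with no measure. Lebesgue measure on (n+1)-tuples is the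
   image, under the cons bijection, of the product of Lebesgue measure on R
   and of Lebesgue measure on n-tuples. *)
Section tuple_lebesgue_succ.
Context (R : realType) (n : nat).
Local Notation T := (measurableTypeR R).
Variable mu : {sigma_finite_measure set (n.-tuple T) -> \bar R}.
Local Open Scope ereal_scope.

Let consp (p : T * n.-tuple T) : n.+1.-tuple T := [tuple of p.1 :: p.2].

Let unconsp (t : n.+1.-tuple T) : T * n.-tuple T :=
  (tnth t ord0, [tuple of behead t]).

Let conspK : cancel consp unconsp.
Proof. by move=> [x t]; congr pair; apply: val_inj. Qed.

Let measurable_consp : measurable_fun [set: T * n.-tuple T] consp.
Proof. exact: measurable_cons. Qed.

Let measurable_unconsp : measurable_fun [set: n.+1.-tuple T] unconsp.
Proof.
apply: measurable_fun_pair; first exact: measurable_tnth.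
exact: measurable_behead.
Qed.

Definition tuple_lebesgue_succ : set (n.+1.-tuple T) -> \bar R :=
  pushforward (@lebesgue_measure R \x mu) consp.

HB.instance Definition _ := Measure.copy tuple_lebesgue_succ
  (measure_function_pushforward__canonical__measure_function_Measure
     (@lebesgue_measure R \x mu) measurable_consp).

Let tuple_lebesgue_succ_sigma_finite : sigma_finite setT tuple_lebesgue_succ.
Proof.
have /sigma_finiteP[F [TF ndF Foo]] := sigma_finiteT (@lebesgue_measure R).
have /sigma_finiteP[G [TG ndG Goo]] := sigma_finiteT mu.
exists (fun k => unconsp @^-1` (F k `*` G k)).
  rewrite -preimage_bigcup -(preimage_setT unconsp); congr (_ @^-1` _).
  apply/esym; rewrite -subTset => -[x t] _.
  have [i _ Fix] : (\bigcup_k F k) x by rewrite -TF.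
  have [j _ Gjt] : (\bigcup_k G k) t by rewrite -TG.
  exists (maxn i j) => //; split => /=.
  - by move: x Fix; exact/subsetPset/ndF/leq_maxl.
  - by move: t Gjt; exact/subsetPset/ndG/leq_maxr.
move=> k; have [mF Fk] := Foo k; have [mG Gk] := Goo k; split.
  by rewrite -[X in measurable X]setTI; apply: measurable_unconsp => //;
    exact: measurableX.
rewrite /tuple_lebesgue_succ /pushforward -comp_preimage.
rewrite (_ : _ \o _ = id) ?preimage_id; last exact/funext/conspK.
by rewrite product_measure1E// lte_mul_pinfty// ge0_fin_numE.
Qed.

HB.instance Definition _ := Measure_isSigmaFinite.Build _ _ _
  tuple_lebesgue_succ tuple_lebesgue_succ_sigma_finite.

End tuple_lebesgue_succ.

Fixpoint tuple_lebesgue (R : realType) (n : nat) :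
    {sigma_finite_measure set (n.-tuple (measurableTypeR R)) -> \bar R} :=
  match n with
  | 0 => \d_([tuple] : 0.-tuple (measurableTypeR R))
  | n'.+1 => tuple_lebesgue_succ (tuple_lebesgue R n')
  end.

Lemma tuple_lebesgue_box (R : realType) (n : nat)
    (A : 'I_n -> set (measurableTypeR R)) :
  (forall i, measurable (A i)) ->
  tuple_lebesgue R n [set t | forall i, A i (tnth t i)] =
  (\prod_(i < n) lebesgue_measure (A i))%E.
Proof.
elim: n A => [|n IHn] A mA.
  rewrite big_ord0 /= diracE mem_set//; by case.
rewrite big_ord_recl -IHn; last by move=> i; exact: mA.
rewrite -product_measure1E//.
  congr (product_measure1 _ _ _); apply/seteqP; split => [[x t] /= At|].
    split; first exact: (At ord0).
    by move=> i; have := At (lift ord0 i); rewrite tnthS.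
  move=> [x t] /= [Ax At] i; case: (unliftP ord0 i) => [j ->|->//].
  by rewrite tnthS.
rewrite (_ : mkset _ =
  \bigcap_(i in [set: 'I_n]) ((@tnth n (measurableTypeR R))^~ i @^-1` A (lift ord0 i))).
  apply: fin_bigcap_measurable => // i _.
  by rewrite -[X in measurable X]setTI; exact: measurable_tnth.
by apply/seteqP; split => [t At i _|t At i]; [exact: At|exact: (At i I)].
Qed.

Section hat_functions.
Context (R : realType).
Local Notation mu := (@lebesgue_measure R).

Definition convolution (f g : R -> R) (x : R) : R :=
  \int[mu]_(y in [set: R]) (f (x - y) * g y).

Definition hat1 (u x : R) : R := \1_(`[- (u / 2), u / 2[%classic) x.

(* Orders start at 1; hat 0 is a placeholder. *)
Fixpoint hat (r : nat) (u : R) : R -> R :=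
  match r with
  | 0 => fun=> 0
  | 1 => hat1 u
  | r'.+1 => convolution (hat r' u) (hat1 u)
  end.

Definition hatd (d r : nat) (x z u : d.-tuple R) : R :=
  \prod_(j < d) hat r (tnth u j) (tnth x j - tnth z j).

Definition shift_int (d : nat) (k : d.-tuple int) (x : d.-tuple R) :
    d.-tuple R :=
  [tuple (tnth k j)%:~R + tnth x j | j < d].

(* The terms are nonnegative and only finitely many of them are nonzero. *)
Definition periodic_hatd (d r : nat) (x z u : d.-tuple R) : R :=
  fine (\esum_(k in [set: d.-tuple int]) (hatd r (shift_int k x) z u)%:E).

Definition unit_cube (d : nat) : set (d.-tuple R) :=
  [set x | forall j, 0 <= tnth x j < 1].

Definition width_range (d : nat) : set (d.-tuple R) :=
  [set u | forall j, 0 < tnth u j <= 2^-1].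

Definition cubature (d m : nat) (lambda : 'I_m -> R)
    (xi : 'I_m -> d.-tuple R) (f : d.-tuple R -> R) : R :=
  \sum_(i < m) lambda i * f (xi i).

(* A cubature formula is given by its weights and its nodes. *)
Definition cubature_class (d : nat) (B : R) (m : nat) :
    set (('I_m -> R) * ('I_m -> d.-tuple R)) :=
  [set q | \sum_(i < m) `|q.1 i| <= B /\ forall i, unit_cube (q.2 i)].

Definition cubature_error (d r m : nat) (lambda : 'I_m -> R)
    (xi : 'I_m -> d.-tuple R) (z u : d.-tuple R) : R :=
  `| \int[tuple_lebesgue R d]_(x in @unit_cube d) periodic_hatd r x z u
     - cubature lambda xi (fun x => periodic_hatd r x z u) |.

(* The supremum and infimum are taken in the extended reals. *)
Definition hat_discrepancy (d r : nat) (B : R) (m : nat) : \bar R :=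
  ereal_inf
    [set ereal_sup
           [set (cubature_error r q.1 q.2 p.1 p.2)%:E
             | p in @unit_cube d `*` @width_range d]
      | q in @cubature_class d B m].

End hat_functions.

(* Main.v *)
Require Import Defs.
From mathcomp Require Import all_boot all_order all_algebra.
From mathcomp Require Import all_classical all_reals all_analysis.
From mathcomp Require Import measurable_realfun.
From mathcomp Require Import ring lra zify.

Set Implicit Arguments.
Unset Strict Implicit.
Unset Printing Implicit Defensive.

Import Order.TTheory GRing.Theory Num.Theory.
Import numFieldNormedType.Exports.

Local Open Scope ring_scope.

(** Write r = 2s, let nu be Lebesgue measure on the unit cube minus the measure
    of the cubature formula, and let k_u(x, z) be the periodized hat of width u
    centred at z. The signed cubature error is E(z, u), the integral of k_u(., z)
    against nu.

    Energy. For even r the hat of order r is the convolution of the hat of order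
    s with itself, so that k_u is a positive semidefinite kernel. Integrating
    E(., u) once more against nu, whose total variation is at most 1 + B, bounds the
    energy of nu for k_u by (1 + B) sup |E|; this is where the bound on the
    weights enters.

    Averaging. In one variable the Fourier coefficient of k_u at a frequency
    k <> 0 is (sin (pi k u) / (pi k)) ^ r, and the average of sin (pi k u) ^ r
    over u is the same for all k <> 0. The average of k_u is therefore a constant
    plus a multiple of the periodic Bernoulli kernel, and its inverse is a
    differential operator of order r plus a multiple of the mean.

    Duality. If K is positive semidefinite with inverse L, Cauchy-Schwarz gives
    (integral of psi d nu) ^ 2 <= (psi, L psi) * (energy of nu for K) for every
    psi. If psi vanishes at the nodes, the left-hand side only sees Lebesgue
    measure.

    Test function. Following Roth, psi is a sum of nonnegative bumps, one for each
    q-adic box that contains no node, over all shapes of boxes of one fixed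
    volume, a small multiple of 1 / m. A bump is a tensor product of B-splines of
    order s + 1, whose s-th differences are Haar functions. By orthogonality
    (psi, L psi) is of the order of the number of shapes, that is
    (log m) ^ (d - 1), whereas the integral of psi is of the order of
    m ^ (- s) (log m) ^ (d - 1) in the same normalization. This gives
    sup |E| >= c m ^ (- r) (log m) ^ (d - 1).

    Discretization. All of this takes place on the cyclic grid of mesh 1 / N,
    with widths u and centres z restricted to multiples of 1 / N, so that the
    core of the proof is finite linear algebra. A hat of width a / N is a
    combination of shifted hats of width 1 / N, with the coefficients box_kernel
    of the autocorrelation of (1 + X + ... + X ^ (a - 1)) ^ s in the group algebra
    of Z / N ([periodization_hat_grid]). Hence a node can be replaced by a
    measure on at most r ^ d grid points, and cubature errors become finite sums
    ([cubature_error_grid]). The averaged kernel is inverted in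
    [mean_kernel_inverse], duality is [tensor_duality], the test function is
    estimated in [sum_test_ge] and [test_form_le], and
    [cyclic_lower_bound] combines them. The grid size N is a power of
    q = r! + 1: the averaging needs N odd and coprime to 1, ..., s, and the boxes
    need s < q. *)

(** * Duality for positive semidefinite kernels *)

Section Duality.
Variable R : realFieldType.

(** A positive upper bound [c] replaces the sum of squares of [b], which may
    vanish and could then not be divided by. *)
Lemma cauchy_schwarz_sum (U : finType) (a b : U -> R) (c : R) :
  0 < c -> \sum_u b u ^+ 2 <= c ->
  (\sum_u a u * b u) ^+ 2 <= c * \sum_u a u ^+ 2.
Proof.
move=> c0 bc; have [S SE] : exists S, S = \sum_u a u * b u by eexists.
rewrite -SE; set A := \sum_u a u ^+ 2.
have : 0 <= \sum_u (c * a u - S * b u) ^+ 2 by apply: sumr_ge0 => u _; exact: sqr_ge0.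
have -> : \sum_u (c * a u - S * b u) ^+ 2 =
   c ^+ 2 * A - 2 * c * S * S + S ^+ 2 * \sum_u b u ^+ 2.
  have -> : 2 * c * S * S = \sum_u 2 * c * S * (a u * b u) by rewrite -mulr_sumr -SE.
  rewrite /A !mulr_sumr -sumrB -big_split /=.
  by apply: eq_bigr => u _; ring.
move=> h.
have h2 : S ^+ 2 * (\sum_u b u ^+ 2) <= S ^+ 2 * c by rewrite ler_wpM2l ?sqr_ge0.
by rewrite -(ler_pM2l c0); lra.
Qed.

(** With phi = L psi, the pairing of [nu] and [psi] is the pairing of [nu] and
    [phi] in the kernel [K], and (phi, K phi) = (psi, L psi); the features [v]
    turn this into Cauchy-Schwarz. *)
Lemma kernel_duality (X U : finType) (K L : X -> X -> R) (v : U -> X -> R)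
    (nu psi : X -> R) (c : R) :
  (forall x y, K x y = \sum_u v u x * v u y) ->
  (forall x y, \sum_z K x z * L z y = (x == y)%:R) ->
  0 < c -> \sum_x \sum_y psi x * L x y * psi y <= c ->
  (\sum_x nu x * psi x) ^+ 2 <= c * \sum_x \sum_y nu x * K x y * nu y.
Proof.
move=> Kv KL c0 cL.
pose phi x := \sum_y L x y * psi y.
have Kphi x : \sum_y K x y * phi y = psi x.
  under eq_bigr => y _ do rewrite /phi mulr_sumr.
  rewrite exchange_big /=.
  under eq_bigr => y _.
    under eq_bigr => z _ do rewrite mulrA.
    rewrite -mulr_suml KL.
    over.
  rewrite (bigD1 x) //= eqxx mul1r big1 ?addr0 // => y /negPf ynx.
  by rewrite eq_sym ynx mul0r.
have KE (f g : X -> R) : \sum_x \sum_y f x * K x y * g y =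
    \sum_u (\sum_x f x * v u x) * (\sum_x g x * v u x).
  under [RHS]eq_bigr => u _ do
    (rewrite mulr_suml; under eq_bigr => x _ do rewrite mulr_sumr).
  rewrite [RHS]exchange_big; apply: eq_bigr => x _ /=.
  rewrite [RHS]exchange_big; apply: eq_bigr => y _ /=.
  by rewrite Kv mulr_sumr mulr_suml; apply: eq_bigr => u _; ring.
have Ephi (f : X -> R) : \sum_x f x * psi x = \sum_x \sum_y f x * K x y * phi y.
  apply: eq_bigr => x _; rewrite -Kphi mulr_sumr.
  by apply: eq_bigr => y _; rewrite mulrA.
rewrite Ephi !KE.
under [X in _ <= _ * X]eq_bigr => u _ do rewrite -expr2.
apply: cauchy_schwarz_sum => //.
under eq_bigr => u _ do rewrite expr2.
rewrite -KE -Ephi; apply: le_trans cL; rewrite le_eqVlt; apply/orP; left.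
apply/eqP; apply: eq_bigr => x _; rewrite mulrC mulr_sumr.
by apply: eq_bigr => y _; rewrite mulrA.
Qed.

(** Features and inverses of a product kernel are products, so duality passes
    to tensor powers of a kernel in one variable. *)
Lemma tensor_duality (T U : finType) (d : nat) (k l : T -> T -> R) (v : U -> T -> R)
    (nu psi : {ffun 'I_d -> T} -> R) (c : R) :
  (forall x y, k x y = \sum_u v u x * v u y) ->
  (forall x y, \sum_z k x z * l z y = (x == y)%:R) ->
  0 < c ->
  \sum_x \sum_(y : {ffun 'I_d -> T}) psi x * (\prod_j l (x j) (y j)) * psi y <= c ->
  (\sum_x nu x * psi x) ^+ 2 <=
    c * \sum_x \sum_(y : {ffun 'I_d -> T}) nu x * (\prod_j k (x j) (y j)) * nu y.
Proof.
move=> kv kl c0 cL.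
apply: (@kernel_duality {ffun 'I_d -> T} {ffun 'I_d -> U}
  (fun x y => \prod_j k (x j) (y j)) (fun x y => \prod_j l (x j) (y j))
  (fun u x => \prod_j v (u j) (x j))) => // x y.
  under eq_bigr => j _ do rewrite kv.
  by rewrite bigA_distr_bigA; apply: eq_bigr => u _; rewrite big_split.
under eq_bigr => z _ do rewrite -big_split /=.
rewrite -(bigA_distr_bigA (fun i z => k (x i) z * l z (y i))) /=.
under eq_bigr => j _ do rewrite kl.
have [->|/eqP nxy] := eqVneq x y; first by rewrite big1 // => j _; rewrite eqxx.
have [j xyj] : exists j, x j != y j.
  apply/existsP; rewrite -negb_forall; apply/negP => /forallP h.
  by apply: nxy; apply/ffunP => j; apply/eqP/h.
by rewrite (bigD1 j) //= (negPf xyj) mul0r.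
Qed.

End Duality.

(** * The averaged kernel on a cyclic group and its inverse *)

Lemma sum_symmetric (V : zmodType) (F : nat -> V) (h : nat) :
  F 0 = 0 -> (forall a, (a <= (2 * h).+1)%N -> F ((2 * h).+1 - a)%N = F a) ->
  \sum_(a < (2 * h).+1) F a = (\sum_(a < h) F a.+1) *+ 2.
Proof.
move=> F0 sym; rewrite -(big_mkord xpredT F) big_ltn // F0 add0r.
rewrite (@big_cat_nat _ _ _ h.+1) //=; last by lia.
rewrite mulr2n; congr (_ + _); first by rewrite big_add1 big_mkord.
rewrite big_nat_rev /= -{1}[h.+1]add0n big_addn big_mkord.
have -> : ((2 * h).+1 - h.+1 = h)%N by lia.
apply: eq_bigr => a _; rewrite -sym; last by have := ltn_ord a; lia.
by congr F; have := ltn_ord a; lia.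
Qed.

Section Circulant.
Variables (R : realFieldType) (p : nat).
Local Notation N := p.+2.

(** Multiplication by X in the group algebra of Z / N, acting on columns of
    coefficients. N is written [p.+2] so that ['I_N] is a ring. *)
Definition cyclic_shift : 'M[R]_N := \matrix_(i, j) (i == j + 1)%:R.
Local Notation circulant := (horner_mx cyclic_shift).

Lemma circulantXn k i j : circulant 'X^k i j = (i == j + k%:R)%:R.
Proof.
rewrite rmorphXn /= horner_mx_X.
elim: k i j => [|k IH] i j; first by rewrite expr0 mxE addr0.
rewrite exprS mxE (bigD1 (j + k%:R)) //= big1 => [|l lk].
  by rewrite IH eqxx mxE mulr1 addr0 -addrA natr1.
by rewrite IH (negPf lk) mulr0.
Qed.

Lemma natr_N0 : N%:R = 0 :> 'I_N.
Proof. by rewrite Zp_nat; apply: val_inj; rewrite /= modnn. Qed.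

Lemma natrN_Zp : (p.+1)%:R = -1 :> 'I_N.
Proof. by apply/eqP; rewrite -addr_eq0 natr1 natr_N0. Qed.

(** The transpose of the shift is its inverse, which is its power of exponent
    N - 1; transposes of circulants thus stay polynomials in the shift, and
    commutativity can be used inside polynomials. *)
Lemma trmx_circulant f : (circulant f)^T = circulant (f \Po 'X^(p.+1)).
Proof.
elim/poly_ind: f => [|f c IH].
  by rewrite comp_poly0 rmorph0 trmx0.
rewrite comp_polyD comp_polyM comp_polyX comp_polyC !rmorphD !rmorphM /=.
rewrite !horner_mx_C linearD /= tr_scalar_mx; congr (_ + _).
have trX : (circulant 'X)^T = circulant 'X^(p.+1).
  apply/matrixP => i j; rewrite mxE -['X]expr1 !circulantXn natrN_Zp.
  by rewrite [in RHS]eq_sym subr_eq.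
by rewrite trmx_mul IH trX -[_ *m _]/(_ * _) -!rmorphM mulrC.
Qed.

Lemma sum_cyclic_unit (u i j : 'I_N) : u \is a GRing.unit ->
  \sum_(a : 'I_N) (i == j + a * u)%:R = 1 :> R.
Proof.
move=> uu; rewrite (bigD1 ((i - j) / u)) //= big1 => [|a au].
  by rewrite divrK // [j + _]addrC subrK eqxx addr0.
case: eqP => // ij; case/eqP: au; by rewrite ij addrAC subrr add0r mulrK.
Qed.

Variable s : nat.
Hypothesis cops : forall k, (0 < k <= s)%N -> coprime N k.

Lemma unit_Zp_sub (l : nat) : (l <= 2 * s)%N -> l != s ->
  (l%:R - s%:R : 'I_N) \is a GRing.unit.
Proof.
have un k : (0 < k <= s)%N -> (k%:R : 'I_N) \is a GRing.unit.
  by move=> hk; rewrite (@unitZpE N) ?cops.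
move=> l2 ls; have [lts|gts|/eqP] := ltngtP l s; last by rewrite (negPf ls).
  rewrite -opprB unitrN -natrB 1?ltnW //; apply: un; lia.
rewrite -natrB 1?ltnW //; apply: un; lia.
Qed.


(** The discrete B-spline of order [s] and width [a]. *)
Definition spline_power (a : nat) : {poly R} := (\sum_(i < a) 'X^i) ^+ s.
Definition difference : {poly R} := (1 - 'X) ^+ s.

Let rev (f : {poly R}) : {poly R} := f \Po 'X^(p.+1).
Let diff_sq (a : nat) := (1 - 'X^a) ^+ s * rev ((1 - 'X^a) ^+ s).

(** A geometric series: convolving by a box of width [a] and taking a unit
    difference amounts to a difference of step [a]. *)
Lemma spline_power_difference a : spline_power a * difference = (1 - 'X^a) ^+ s.
Proof.
rewrite -exprMn_comm; last exact: mulrC.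
by rewrite -(opprB 'X) mulrN mulrC -subrX1 opprB.
Qed.


Lemma circulantXnK a : circulant 'X^a * circulant (rev 'X^a) = 1.
Proof.
rewrite -rmorphM /rev rmorphXn /= comp_polyX -exprM -exprD.
apply/matrixP => i j; rewrite circulantXn !mxE.
by rewrite natrD natrM natrN_Zp mulN1r subrr addr0.
Qed.

(** If zy = 1 then (1 - z)(1 - y) = - y (1 - z)^2; hence the s-th power is a
    sum of powers z^(l - s) weighted by signed binomials, the discrete form of
    sin (pi k u) ^ (2 s). *)
Lemma circulant_diff_sq a i j : circulant (diff_sq a) i j =
  \sum_(l < (2 * s).+1)
    (-1) ^+ (s + l) * 'C(2 * s, l)%:R * (i == j + a%:R * (l%:R - s%:R))%:R.
Proof.
pose z : {poly R} := 'X^a; pose y := rev z.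
have zy1 : circulant (z * y) = 1 by rewrite rmorphM circulantXnK.
have -> : circulant (diff_sq a) = circulant ((-1) ^+ s * y ^+ s * (1 - z) ^+ (2 * s)).
  rewrite /diff_sq /rev rmorphXn rmorphB rmorph1 -/z -/(rev z) -/y.
  rewrite exprM -!exprMn 2![circulant (_ ^+ s)]rmorphXn; congr (_ ^+ s).
  (* The last term is killed by zy = 1. *)
  have -> : (1 - z) * (1 - y) = -1 * y * (1 - z) ^+ 2 + (z * y - 1) * (z - 1) by ring.
  rewrite rmorphD [X in _ + X]rmorphM [X in _ + X * _]rmorphB /=.
  by rewrite zy1 rmorph1 subrr mul0r addr0.
rewrite exprBn mulr_sumr rmorph_sum summxE /=; apply: eq_bigr => l _.
rewrite expr1n mulr1 /y /z /rev rmorphXn /= comp_polyX -!exprM.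
have -> : (-1) ^+ s * 'X^(p.+1 * (a * s)) * ((-1) ^+ l * 'X^(a * l) *+ 'C(2 * s, l)) =
   ((-1) ^+ (s + l) * 'C(2 * s, l)%:R)%:P * 'X^(p.+1 * (a * s) + a * l) :> {poly R}.
  rewrite !exprD -mulr_natr polyCM rmorphM !rmorphXn rmorphN1 rmorph_nat /=.
  ring.
rewrite rmorphM /= horner_mx_C -[_%:M * _]/(_%:M *m _) mul_scalar_mx mxE circulantXn; congr (_ * (_ == _ + _)%:R).
by rewrite natrD !natrM natrN_Zp; ring.

Qed.

Hypothesis s0 : (0 < s)%N.

(** When [a] runs over Z / N, the shifts by a (l - s) with l <> s equidistribute
    because l - s is invertible mod N; only the term l = s remembers the
    position. This is the averaging that makes the result independent of the
    frequency. *)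
Lemma sum_circulant_diff_sq i j : \sum_(a < N) circulant (diff_sq a) i j =
  'C(2 * s, s)%:R * (N%:R * (i == j)%:R - 1).
Proof.
under eq_bigr => a _ do rewrite circulant_diff_sq.
rewrite exchange_big /=.
have hs : (s < (2 * s).+1)%N by lia.
have alt : \sum_(l < (2 * s).+1) (-1) ^+ (s + l) * 'C(2 * s, l)%:R = 0 :> R.
  transitivity ((-1) ^+ s * (1 - 1) ^+ (2 * s) :> R).
    rewrite exprBn mulr_sumr; apply: eq_bigr => l _.
    by rewrite !expr1n !mulr1 exprD -[in RHS]mulr_natr mulrA.
  by rewrite subrr expr0n; case: (s) s0 => // s' _; rewrite mulr0.
have ss : (-1) ^+ (s + s) = 1 :> R by rewrite exprD -expr2 sqrr_sign.
rewrite (bigD1 (Ordinal hs)) //=.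
rewrite (bigD1 (Ordinal hs)) //= ss mul1r in alt.
under eq_bigr => a _ do rewrite subrr mulr0 addr0 ss mul1r.
rewrite sumr_const card_ord.
rewrite [X in _ + X](eq_bigr (fun l : 'I_(2 * s).+1 =>
    (-1) ^+ (s + l) * 'C(2 * s, l)%:R)); last first.
  move=> l ls; rewrite -mulr_sumr.
  under eq_bigr => a _ do rewrite natr_Zp.
  by rewrite sum_cyclic_unit ?mulr1 //; apply: unit_Zp_sub; rewrite ?leq_ord // -ltnS.
rewrite -mulr_natl; move: (\sum_(l < _ | _) _) alt => x /eqP.
by rewrite addr_eq0 => /eqP ->; ring.
Qed.


(** The kernel of the periodized hat of order 2s and width a / N, expressed in
    the hats of width 1 / N. *)
Definition box_kernel (a : nat) : 'M[R]_N :=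
  circulant (spline_power a) *m (circulant (spline_power a))^T.

(** The widths a = 1, ..., h with N = 2h + 1 are the admissible ones, at most
    1 / 2 after division by N. *)
Definition mean_kernel (h : nat) : 'M[R]_N := \sum_(a < h) box_kernel a.+1.

Let J : 'M[R]_N := const_mx 1.

Lemma circulant_const f : circulant f *m J = f.[1] *: J.
Proof.
elim/poly_ind: f => [|f c IH]; first by rewrite rmorph0 mul0mx horner0 scale0r.
rewrite rmorphD rmorphM /= horner_mx_C mulmxDl -mulmxE -mulmxA mul_scalar_mx.
have -> : circulant 'X *m J = J.
  apply/matrixP => i j; rewrite mxE -['X]expr1 (bigD1 (i - 1)) //=.
  rewrite circulantXn subrK eqxx !mxE mulr1 big1 ?addr0 // => k ki.
  rewrite circulantXn mxE mulr1 -subr_eq eq_sym; case: eqP => // e.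
  by rewrite e eqxx in ki.
by rewrite IH hornerMXaddC mulr1 scalerDl.
Qed.

Lemma horner_rev1 f : (rev f).[1] = f.[1].
Proof. by rewrite /rev horner_comp hornerXn expr1n. Qed.

Lemma spline_power1 a : (spline_power a).[1] = a%:R ^+ s.
Proof.
rewrite /spline_power horner_exp horner_sum.
under eq_bigr => i _ do rewrite hornerXn expr1n.
by rewrite sumr_const card_ord.
Qed.

Lemma box_kernel_const a : box_kernel a *m J = a%:R ^+ (2 * s) *: J.
Proof.
rewrite /box_kernel -mulmxA trmx_circulant circulant_const horner_rev1.
by rewrite -scalemxAr circulant_const spline_power1 scalerA -exprD addnn mul2n.
Qed.

Lemma sum_box_kernel a i : \sum_j box_kernel a i j = a%:R ^+ (2 * s).
Proof.
have /matrixP/(_ i i) := box_kernel_const a; rewrite !mxE mulr1 => <-.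
by apply: eq_bigr => j _; rewrite [J _ _]mxE mulr1.
Qed.

Lemma box_kernel_difference a :
  box_kernel a *m ((circulant difference)^T *m circulant difference) =
  circulant (diff_sq a).
Proof.
have cM f g : circulant f *m circulant g = circulant (f * g) by rewrite rmorphM.
rewrite /box_kernel !trmx_circulant !cM /diff_sq -!spline_power_difference.
rewrite -/(rev (spline_power a)) -/(rev difference).
have -> : rev (spline_power a * difference) = rev (spline_power a) * rev difference.
  exact: rmorphM.
by congr (horner_mx _ _); ring.
Qed.

Variable h : nat.
Hypothesis Nh : N = (2 * h).+1.

(** Opposite steps give the same squared difference. It lets the average over the
    widths 1, ..., h be computed from the average over the whole of Z / N. *)
Lemma diff_sq_sym a : (a <= N)%N -> circulant (diff_sq (N - a)) = circulant (diff_sq a).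
Proof.
move=> aN; have revX a' : rev 'X^a' = 'X^(p.+1 * a').
  by rewrite [LHS]rmorphXn /= comp_polyX exprM.
have eX f : circulant ((1 - f) ^+ s) = (1 - circulant f) ^+ s.
  by rewrite [LHS]rmorphXn; congr (_ ^+ s); rewrite [LHS]rmorphB rmorph1.
have dE a' : circulant (diff_sq a') =
    (1 - circulant 'X^a') ^+ s * (1 - circulant (rev 'X^a')) ^+ s.
  rewrite -!eX [LHS]rmorphM; congr (_ * circulant _).
  by rewrite [LHS]rmorphXn; congr (_ ^+ s); rewrite [LHS]rmorphB rmorph1.
have e1 : circulant 'X^(N - a) = circulant (rev 'X^a).
  apply/matrixP => i j; rewrite revX !circulantXn.
  by rewrite natrM natrN_Zp natrB // natr_N0 mulN1r add0r.
have e2 : circulant (rev 'X^(N - a)) = circulant 'X^a.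
  apply/matrixP => i j; rewrite revX !circulantXn.
  by rewrite natrM natrN_Zp natrB // natr_N0 mulN1r add0r opprK.
have cC f g : circulant f * circulant g = circulant g * circulant f.
  by rewrite -(rmorphM (horner_mx cyclic_shift)) mulrC; exact: rmorphM.
by rewrite !dE e1 e2 -!eX cC.
Qed.

Lemma half_sum_diff_sq :
  \sum_(a < h) circulant (diff_sq a.+1) = ('C(2 * s, s)%:R / 2) *: (N%:R%:M - J).
Proof.
have z : circulant (diff_sq 0) = 0.
  by rewrite /diff_sq expr0 subrr expr0n eqn0Ngt s0 mul0r rmorph0.
have : \sum_(a < N) circulant (diff_sq a) = (\sum_(a < h) circulant (diff_sq a.+1)) *+ 2.
  have := @sum_symmetric _ (fun a => circulant (diff_sq a)) h z.
  by rewrite -Nh; apply; exact: diff_sq_sym.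
move=> /matrixP e; apply/matrixP => i j; have := e i j.
rewrite summxE sum_circulant_diff_sq !mxE => ee.
apply: (@mulfI _ 2); first by rewrite pnatr_eq0.
by rewrite [LHS]mulr_natl mulr2n -ee mulr_natr; case: (i == j); rewrite ?mulr1n ?mulr0n; field.
Qed.

(** A multiple of the difference operator of order 2s, which inverts the averaged
    kernel on functions of mean zero, plus a multiple of the mean, which inverts
    it on constants. *)
Definition mean_inverse : 'M[R]_N :=
  ('C(2 * s, s)%:R / 2 * N%:R)^-1 *: ((circulant difference)^T *m circulant difference)
  + (N%:R * \sum_(a < h) a.+1%:R ^+ (2 * s))^-1 *: J.

Lemma mean_kernel_inverse : mean_kernel h *m mean_inverse = 1%:M.
Proof.
rewrite mulmxDr -!scalemxAr /mean_kernel !mulmx_suml.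
under eq_bigr => a _ do rewrite box_kernel_difference.
rewrite half_sum_diff_sq.
under [X in _ + _ *: X]eq_bigr => a _ do rewrite box_kernel_const.
rewrite -scaler_suml !scalerA.
set A := \sum_(a < h) _.
have h0 : (0 < h)%N by lia.
have A0 : A != 0.
  apply: lt0r_neq0; rewrite /A; case: (h) h0 => // h' _.
  rewrite big_ord_recl; apply: ltr_wpDr; last by rewrite exprn_gt0 // ltr0n.
  by apply: sumr_ge0 => i _; rewrite exprn_ge0.
have N0 : N%:R != 0 :> R by rewrite pnatr_eq0.
have C0 : 'C(2 * s, s)%:R != 0 :> R.
  by rewrite pnatr_eq0 -lt0n bin_gt0; lia.
apply/matrixP => i j; rewrite !mxE.
move: (N%:R) N0 ('C(_, _)%:R) C0 (A) A0 => n n0 c c0 A' A0.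
by case: (i == j); rewrite ?mulr1n ?mulr0n; field; rewrite A0 c0 n0.
Qed.

End Circulant.

(** * Discrete splines and Haar functions *)

Section CoefVector.
Variables (R : realFieldType) (p s : nat).
Local Notation N := p.+2.
Local Notation circulant := (horner_mx (cyclic_shift R p)).

Lemma circulant_delta (f : {poly R}) : (size f <= N)%N ->
  circulant f *m delta_mx 0 0 = \col_(i < N) f`_i :> 'cV[R]_N.
Proof.
move=> fN; apply/matrixP => i j.
have -> : f = \sum_(k < N) f`_k *: 'X^k.
  rewrite -poly_def; apply/polyP => k; rewrite coef_poly; case: ltnP => // Nk.
  by rewrite nth_default // (leq_trans fN).
rewrite rmorph_sum mulmx_suml summxE mxE coef_sum; apply: eq_bigr => k _.
rewrite -mul_polyC rmorphM /= horner_mx_C -mulmxA mul_scalar_mx mxE mul_polyC coefZ coefXn; congr (_ * _).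
rewrite mxE (bigD1 0) //= circulantXn add0r natr_Zp mxE eqxx (ord1 j) mulr1.
rewrite big1 ?addr0 // => l l0; by rewrite mxE (negPf l0) mulr0.
Qed.

Lemma difference_coef (f : {poly R}) :
  (size (difference R s * f)%R <= N)%N -> (size f <= N)%N ->
  circulant (difference R s) *m (\col_(i < N) f`_i) =
  \col_(i < N) (difference R s * f)`_i.
Proof.
by move=> h1 h2; rewrite -!circulant_delta // rmorphM mulmxA.
Qed.

Lemma horner1_coef (f : {poly R}) : (size f <= N)%N -> f.[1] = \sum_(i < N) f`_i.
Proof.
move=> fN; rewrite (horner_coef_wide _ fN); apply: eq_bigr => i _.
by rewrite expr1n mulr1.
Qed.

(** The form of the inverse kernel only involves s-th differences and means.
    The bounds on sizes say that nothing wraps around the cycle, so that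
    differences can be computed on polynomials. *)
Lemma mean_inverse_form (h : nat) (f g : {poly R}) :
  (size f <= N)%N -> (size g <= N)%N ->
  (size (difference R s * f)%R <= N)%N -> (size (difference R s * g)%R <= N)%N ->
  \sum_(x < N) \sum_(y < N) f`_x * mean_inverse R p s h x y * g`_y =
  ('C(2 * s, s)%:R / 2 * N%:R)^-1 *
     \sum_(x < N) (difference R s * f)`_x * (difference R s * g)`_x +
  (N%:R * \sum_(a < h) a.+1%:R ^+ (2 * s))^-1 * (f.[1] * g.[1]).
Proof.
move=> fN gN DfN DgN.
pose F := \col_(i < N) f`_i; pose G := \col_(i < N) g`_i.
have bump_formE (A : 'M[R]_N) :
    \sum_(x < N) \sum_(y < N) f`_x * A x y * g`_y = (F^T *m (A *m G)) 0 0.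
  rewrite mxE; apply: eq_bigr => x _; rewrite !mxE mulr_sumr.
  by apply: eq_bigr => y _; rewrite mxE mulrA.
rewrite bump_formE /mean_inverse mulmxDl mulmxDr -!scalemxAl -!scalemxAr.
rewrite mxE [X in X + _]mxE [X in _ + X]mxE; congr (_ * _ + _ * _).
  have -> (D : 'M[R]_N) : F^T *m (D^T *m D *m G) = (D *m F)^T *m (D *m G).
    by rewrite trmx_mul !mulmxA.
  by rewrite !difference_coef // mxE; apply: eq_bigr => x _; rewrite !mxE.
rewrite !horner1_coef // mxE mulr_suml; apply: eq_bigr => x _; rewrite !mxE; congr (_ * _).
by apply: eq_bigr => y _; rewrite !mxE mul1r.
Qed.

End CoefVector.

Section Splines.
Variables (R : realFieldType) (s : nat).

(** The B-spline of order [s.+1] and mesh [L], starting at [M]. *)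
Definition bspline (L M : nat) : {poly R} := 'X^M * (\sum_(i < L) 'X^i) ^+ s.+1.
Definition haar (L M : nat) : {poly R} := difference R s * bspline L M.

Lemma size_geometric L : (0 < L)%N -> size (\sum_(i < L) 'X^i : {poly R}) = L.
Proof.
case: L => // L _.
have -> : \sum_(i < L.+1) 'X^i = \poly_(i < L.+1) 1 :> {poly R}.
  by rewrite poly_def; apply: eq_bigr => i _; rewrite scale1r.
by rewrite size_poly_eq // oner_neq0.
Qed.

(** Telescoping s of the s + 1 geometric sums leaves s-th differences of mesh L of
    an indicator of length L: a step function with s + 1 steps. *)
Lemma haarE L M : haar L M = 'X^M * ((1 - 'X^L) ^+ s * \sum_(i < L) 'X^i).
Proof.
rewrite /haar /bspline exprSr mulrCA mulrA [_ * (_ * _)]mulrA.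
by rewrite -spline_power_difference /spline_power -mulrA [in RHS]mulrCA; ring.
Qed.

Lemma size_bspline L M : (0 < L)%N -> (size (bspline L M) <= M + s.+1 * L)%N.
Proof.
move=> L0; rewrite /bspline mulrC size_mulXn ?expf_neq0 -?size_poly_eq0 ?size_geometric -?lt0n //.
rewrite leq_add2l; apply: leq_trans (size_poly_exp_leq _ _) _.
by rewrite size_geometric //; nia.
Qed.

Lemma bspline1 L M : (bspline L M).[1] = L%:R ^+ s.+1.
Proof.
rewrite /bspline hornerM hornerXn expr1n mul1r horner_exp horner_sum.
under eq_bigr => i _ do rewrite hornerXn expr1n.
by rewrite sumr_const card_ord.
Qed.

Lemma haar1 L M : (0 < s)%N -> (haar L M).[1] = 0.
Proof.
move=> s0; rewrite /haar /difference hornerM horner_exp hornerD hornerN hornerX hornerC.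
by rewrite subrr expr0n (gtn_eqF s0) mul0r.
Qed.

Lemma bspline_coef_lt L M x : (x < M)%N -> (bspline L M)`_x = 0.
Proof. by move=> xM; rewrite /bspline coefXnM xM. Qed.

(** The steps of [haar], indexed by all natural numbers: the binomial vanishes
    beyond [s]. *)
Definition haar_step (j : nat) : R := (-1) ^+ j * 'C(s, j)%:R.

Lemma haar_coef L M x : (0 < L)%N ->
  (haar L M)`_x = (M <= x)%:R * haar_step ((x - M) %/ L).
Proof.
move=> L0; rewrite haarE coefXnM ltnNge; case: leqP => Mx /=; last by rewrite mul0r.
rewrite mul1r; move: (x - M)%N => {Mx M} x.
have -> : (1 - 'X^L) ^+ s = \sum_(j < s.+1) haar_step j *: 'X^(L * j) :> {poly R}.
  rewrite exprBn; apply: eq_bigr => j _.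
  rewrite expr1n mulr1 -exprM -mulr_natr /haar_step -mul_polyC polyCM rmorphXn rmorphN1 rmorph_nat /=; ring.
rewrite mulr_suml coef_sum.
have e (j : nat) : (if (x < L * j)%N then 0 else \sum_(i < L) ('X^i : {poly R})`_(x - L * j)) =
   (j == x %/ L)%N%:R.
  have -> : (j == x %/ L)%N = (L * j <= x < L * j + L)%N.
    by rewrite eqn_leq leq_divRL // -[(x %/ L <= j)%N]ltnS ltn_divLR // mulSn mulnC addnC.
  case: ltnP => //= hx.
  have [h2|h2] := ltnP x (L * j + L).
    have hi : (x - L * j < L)%N by lia.
    rewrite (bigD1 (Ordinal hi)) //= coefXn eqxx big1 ?addr0 // => i ii.
    rewrite coefXn; case: eqP => // ei; case/eqP: ii; apply: val_inj; exact/esym.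
  rewrite big1 // => i _; rewrite coefXn; case: eqP => // ei.
  by have := ltn_ord i; lia.
rewrite (eq_bigr (fun j : 'I_s.+1 => haar_step j * (j == (x %/ L)%N :> nat)%:R)); last first.
  by move=> j _; rewrite -e -scalerAl coefZ coefXnM coef_sum.
have [xs|xs] := ltnP (x %/ L) s.+1.
  rewrite (bigD1 (Ordinal xs)) //= eqxx mulr1 big1 ?addr0 // => j jx.
  by case: eqP => [ej|_]; rewrite ?mulr0 //; case/eqP: jx; apply: val_inj.
rewrite big1 => [|j _]; first by rewrite /haar_step bin_small ?mulr0 //.
by case: eqP => [ej|_]; rewrite ?mulr0 //; have := ltn_ord j; lia.
Qed.

Lemma size_haar L M : (0 < L)%N -> (size (haar L M) <= M + s.+1 * L)%N.
Proof.
move=> L0; apply/leq_sizeP => j hj; rewrite haar_coef // /haar_step bin_small ?mulr0 //.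
by rewrite leq_divRL //; lia.
Qed.

End Splines.

(** * Orthogonality of the Haar functions *)

Section HaarSystem.
Variables (R : realFieldType) (s q t p : nat).
Hypotheses (s0 : (0 < s)%N) (sq : (s < q)%N) (Nq : p.+2 = (q ^ t.+1)%N).
Local Notation N := p.+2.

(** The box of level [k] has length [q * bump_width k], and consists of [q] cells
    of length [bump_width k]; the s + 1 steps of the Haar function live on its
    first cells, whence the hypothesis s < q. *)
Definition bump_width (k : nat) : nat := (q ^ (t - k))%N.
(** [k] is the level and [c < q ^ k] the position of the box. *)
Definition bump (k c : nat) : {poly R} := bspline R s (bump_width k) (c * (q * bump_width k)).
Definition bump_haar (k c : nat) : {poly R} := haar R s (bump_width k) (c * (q * bump_width k)).

Let q0 : (0 < q)%N. Proof. exact: leq_ltn_trans sq. Qed.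

Lemma bump_width_gt0 k : (0 < bump_width k)%N. Proof. by rewrite expn_gt0 q0. Qed.

Lemma bump_haarE k c : difference R s * bump k c = bump_haar k c. Proof. by []. Qed.

Let end_le k c : (k <= t)%N -> (c < q ^ k)%N ->
  (c * (q * bump_width k) + s.+1 * bump_width k <= N)%N.
Proof.
move=> kt ck; rewrite Nq (_ : (q ^ t.+1 = q ^ k * (q * bump_width k))%N); last first.
  by rewrite mulnCA -expnD expnS subnKC.
apply: (@leq_trans (c.+1 * (q * bump_width k))); last by rewrite leq_mul2r ck orbT.
by rewrite [(c.+1 * _)%N]mulSn addnC leq_add2r leq_mul2r sq orbT.
Qed.

Lemma size_bump k c : (k <= t)%N -> (c < q ^ k)%N -> (size (bump k c) <= N)%N.
Proof.
by move=> kt ck; apply: leq_trans (size_bspline _ _ _ (bump_width_gt0 k)) (end_le kt ck).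
Qed.

Lemma size_bump_haar k c : (k <= t)%N -> (c < q ^ k)%N -> (size (bump_haar k c) <= N)%N.
Proof.
by move=> kt ck; apply: leq_trans (size_haar _ _ _ (bump_width_gt0 k)) (end_le kt ck).
Qed.

Lemma bump_box k c x : (c * (q * bump_width k) <= x < c * (q * bump_width k) + s.+1 * bump_width k)%N ->
  (x %/ (q * bump_width k) = c)%N.
Proof.
move=> /andP[h1 h2]; have w0 : (0 < q * bump_width k)%N by rewrite muln_gt0 q0 bump_width_gt0.
apply/eqP; rewrite eqn_leq -ltnS ltn_divLR // leq_divRL // h1 andbT.
apply: leq_trans h2 _.
by rewrite [(c.+1 * _)%N]mulSn addnC leq_add2r leq_mul2r sq orbT.
Qed.

Lemma bump_support k c x : (x %/ (q * bump_width k))%N != c -> (bump k c)`_x = 0.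
Proof.
move=> xc; have [h1|h1] := ltnP x (c * (q * bump_width k)); first exact: bspline_coef_lt.
have [h2|h2] := ltnP x (c * (q * bump_width k) + s.+1 * bump_width k).
  by rewrite (@bump_box k c) ?h1 ?eqxx in xc.
by rewrite nth_default // (leq_trans (size_bspline _ _ _ (bump_width_gt0 k))).
Qed.

Lemma bump_haar_support k c x : (x %/ (q * bump_width k))%N != c -> (bump_haar k c)`_x = 0.
Proof.
move=> xc; have [h1|h1] := ltnP x (c * (q * bump_width k)).
  by rewrite haar_coef ?bump_width_gt0 // leqNgt h1 mul0r.
have [h2|h2] := ltnP x (c * (q * bump_width k) + s.+1 * bump_width k).
  by rewrite (@bump_box k c) ?h1 ?eqxx in xc.
by rewrite nth_default // (leq_trans (size_haar _ _ _ (bump_width_gt0 k))).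
Qed.

(** Haar functions of level [k] are constant on the cells of level [k]. *)
Lemma bump_haar_const k c x : (bump_haar k c)`_x =
  (c * q <= x %/ bump_width k)%N%:R * haar_step R s (x %/ bump_width k - c * q).
Proof.
have w0 := bump_width_gt0 k.
rewrite haar_coef // mulnA leq_divRL //; case: leqP => //= h; rewrite ?mul0r // !mul1r.
by rewrite -[in RHS](subnKC h) divnMDl // addKn.
Qed.

(** A box of a finer level lies inside one cell of the coarser level, where the
    coarser Haar function is constant, and the finer one has mean zero. *)
Lemma bump_haar_orth_lt k k' c c' : (k < k' <= t)%N -> (c' < q ^ k')%N ->
  \sum_(x < N) (bump_haar k c)`_x * (bump_haar k' c')`_x = 0.
Proof.
move=> /andP[kk' k't] c'k'.
pose e := (q ^ (k' - k).-1)%N.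
have we : (bump_width k = q * bump_width k' * e)%N.
  by rewrite /bump_width /e -expnS -expnD; congr (q ^ _)%N; lia.
pose g := (c * q <= c' %/ e)%N%:R * haar_step R s (c' %/ e - c * q).
(* On the finer box the coarser function takes the single value [g]. *)
transitivity (\sum_(x < N) g * (bump_haar k' c')`_x).
  apply: eq_bigr => x _; have [h|h] := eqVneq (x %/ (q * bump_width k'))%N c'.
    by rewrite bump_haar_const we divnMA h.
  by rewrite (bump_haar_support h) !mulr0.
by rewrite -mulr_sumr -horner1_coef ?size_bump_haar // haar1 // mulr0.
Qed.

Lemma bump_haar_orth k k' c c' : (k <= t)%N -> (k' <= t)%N ->
  (c < q ^ k)%N -> (c' < q ^ k')%N -> ~~ ((k == k') && (c == c')) ->
  \sum_(x < N) (bump_haar k c)`_x * (bump_haar k' c')`_x = 0.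
Proof.
move=> kt k't ck ck'; have [h|h|->] := ltngtP k k' => /= cc'.
- by rewrite bump_haar_orth_lt ?h.
- under eq_bigr => x _ do rewrite mulrC.
  by rewrite bump_haar_orth_lt ?h.
rewrite big1 // => x _; have [h|h] := eqVneq (x %/ (q * bump_width k'))%N c.
  by rewrite [X in _ * X]bump_haar_support ?mulr0 // h.
by rewrite bump_haar_support // mul0r.
Qed.

Lemma bump_haar_sqr_le k c x : (bump_haar k c)`_x ^+ 2 <=
   (x %/ (q * bump_width k) == c)%N%:R * 4 ^+ s.
Proof.
have [h|h] := eqVneq (x %/ (q * bump_width k))%N c; last first.
  by rewrite bump_haar_support // expr0n mul0r.
rewrite bump_haar_const /haar_step !exprMn sqrr_sign !mul1r.
have b1 (b : bool) : 0 <= (b%:R : R) ^+ 2 <= 1 by case: b; rewrite ?expr1n ?expr0n ?lexx ?ler01.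
set j := (_ - _)%N; set b := (_ <= _)%N; have /andP[b0 bl] := b1 b.
apply: (@le_trans _ _ (('C(s, j)%:R : R) ^+ 2)); first by rewrite ler_piMl ?sqr_ge0.
have hC : ('C(s, j)%:R : R) <= 2 ^+ s.
  rewrite -natrX ler_nat; have [js|js] := leqP j s; last by rewrite bin_small.
  have -> : (2 ^ s = \sum_(i < s.+1) 'C(s, i))%N.
    by rewrite -[2%N]/(1 + 1)%N expnDn; apply: eq_bigr => i _; rewrite !exp1n !muln1.
  have js' : (j < s.+1)%N by [].
  by rewrite (bigD1 (Ordinal js')) //= leq_addr.
by rewrite (_ : 4 = 2 ^+ 2) -?exprM 1?mulnC ?exprM ?lerXn2r ?nnegrE ?exprn_ge0 // expr2; ring.
Qed.

(** Off-diagonal terms vanish. On the diagonal each point lies in one box of level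
    [k], so the squares add up to at most N times the bound on one square. *)
Lemma sum_bump_haar_le k k' : (k <= t)%N -> (k' <= t)%N ->
  \sum_(c < q ^ k) \sum_(c' < q ^ k')
     \sum_(x < N) (bump_haar k c)`_x * (bump_haar k' c')`_x <=
  (k == k')%:R * (N%:R * 4 ^+ s).
Proof.
move=> kt k't; have [kk'|nk] := eqVneq k k'; last first.
  rewrite mul0r big1 // => c _; rewrite big1 // => c' _.
  by rewrite bump_haar_orth ?ltn_ord // (negPf nk).
rewrite -{k' k't}kk' mul1r.
apply: (@le_trans _ _ (\sum_(c < q ^ k) \sum_(x < N) (bump_haar k c)`_x ^+ 2)).
  rewrite le_eqVlt; apply/orP; left; apply/eqP; apply: eq_bigr => c _.
  rewrite (bigD1 c) //= [X in _ + X]big1 => [|c' cc'].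
    by rewrite addr0; apply: eq_bigr => x _; rewrite expr2.
  by rewrite bump_haar_orth ?ltn_ord // eqxx /= eq_sym.
rewrite exchange_big /= mulr_natl -[X in _ *+ X]card_ord -sumr_const.
apply: ler_sum => x _.
apply: (@le_trans _ _ (\sum_(c < q ^ k) (x %/ (q * bump_width k) == c)%N%:R * 4 ^+ s)).
  by apply: ler_sum => c _; exact: bump_haar_sqr_le.
rewrite -mulr_suml ler_piMl ?exprn_ge0 //.
have [h|h] := ltnP (x %/ (q * bump_width k)) (q ^ k).
  rewrite (bigD1 (Ordinal h)) //= eqxx big1 ?addr0 // => c.
  by rewrite -val_eqE /= eq_sym => /negPf ->.
rewrite big1 ?ler01 // => c _; case: eqP => // e.
by rewrite e leqNgt ltn_ord in h.
Qed.

End HaarSystem.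

(** * The inverse form on splines *)

(** The tangent inequality for powers. *)
Lemma expnS_le_add (h r : nat) : (h.+1 ^ r.+1 <= h ^ r.+1 + r.+1 * h.+1 ^ r)%N.
Proof.
elim: r => [|r IH]; first by rewrite !expn1 expn0; lia.
rewrite expnS mulSn.
apply: (@leq_trans (h.+1 ^ r.+1 + h * (h ^ r.+1 + r.+1 * h.+1 ^ r))).
  by rewrite leq_add2l leq_mul2l IH orbT.
rewrite mulnDr -expnS [(r.+2 * _)%N]mulSn addnCA leq_add2l leq_add2l.
by rewrite mulnCA leq_mul2l [(h.+1 ^ r.+1)%N]expnS leq_mul2r leqnSn !orbT.
Qed.

Lemma power_sum_ge (h r : nat) : (h ^ r.+1 <= r.+1 * \sum_(a < h) a.+1 ^ r)%N.
Proof.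
elim: h => [|h IH]; first by rewrite exp0n.
rewrite big_ord_recr /= mulnDr; apply: leq_trans (expnS_le_add h r) _.
by rewrite leq_add2r.
Qed.

Section Form.
Variables (R : realFieldType) (s q t p h : nat).
Hypotheses (s0 : (0 < s)%N) (sq : (s < q)%N) (Nq : p.+2 = (q ^ t.+1)%N).
Hypothesis Nh : p.+2 = (2 * h).+1.
Local Notation N := p.+2.

Definition bump_form (k c k' c' : nat) : R :=
  \sum_(x < N) \sum_(y < N)
    (bump R s q t k c)`_x * mean_inverse R p s h x y * (bump R s q t k' c')`_y.

Let mean_coef : R := (N%:R * \sum_(a < h) a.+1%:R ^+ (2 * s))^-1.
Let diff_coef : R := ('C(2 * s, s)%:R / 2 * N%:R)^-1.

Let mean_coef_ge0 : 0 <= mean_coef.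
Proof.
by rewrite invr_ge0 mulr_ge0 ?ler0n // sumr_ge0 // => i _; rewrite exprn_ge0.
Qed.

Let diff_coef_ge0 : 0 <= diff_coef.
Proof. by rewrite invr_ge0 !mulr_ge0 ?ler0n // invr_ge0. Qed.

Lemma bump_formE k c k' c' : (k <= t)%N -> (k' <= t)%N -> (c < q ^ k)%N -> (c' < q ^ k')%N ->
  bump_form k c k' c' =
  diff_coef * (\sum_(x < N) (bump_haar R s q t k c)`_x * (bump_haar R s q t k' c')`_x) +
  mean_coef * ((bump_width q t k)%:R ^+ s.+1 * (bump_width q t k')%:R ^+ s.+1).
Proof.
move=> kt k't ck ck'.
have hs := size_bump_haar R sq Nq; have hb := size_bump R sq Nq.
by rewrite /bump_form mean_inverse_form ?bump_haarE ?hs ?hb // /bump !bspline1.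
Qed.

(** Nonnegativity lets sums over the boxes without nodes be bounded by sums over
    all boxes. *)
Lemma bump_form_ge0 k c k' c' : (k <= t)%N -> (k' <= t)%N -> (c < q ^ k)%N -> (c' < q ^ k')%N ->
  0 <= bump_form k c k' c'.
Proof.
move=> kt k't ck ck'; rewrite bump_formE //.
apply: addr_ge0; last by rewrite mulr_ge0 // mulr_ge0 // exprn_ge0.
apply: mulr_ge0 => //.
have [/andP[/eqP<- /eqP<-]|n] := boolP ((k == k') && (c == c')).
  by apply: sumr_ge0 => x _; rewrite -expr2 sqr_ge0.
by rewrite (bump_haar_orth R s0 sq Nq).
Qed.

(** The product is (q ^ (t (s + 1))) / q ^ (k s): the sum of the masses of the bumps
    of level [k] decays geometrically in [k]. *)
Let level_weight k : (k <= t)%N ->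
  (q ^ k)%:R * (bump_width q t k)%:R ^+ s.+1 <= N%:R ^+ s.+1 * 2 ^- k :> R.
Proof.
move=> kt; rewrite ler_pdivlMr ?exprn_gt0 // -!natrX -!natrM ler_nat.
have q2 : (2 <= q)%N by lia.
apply: (@leq_trans ((q ^ k * bump_width q t k) ^ s.+1)).
  rewrite expnMn mulnAC leq_mul2r; apply/orP; right.
  rewrite expnS leq_mul2l; apply/orP; right.
  apply: (@leq_trans (q ^ k)); first by case: (k) => [|k0]; rewrite ?expn0 ?leq_exp2r.
  by rewrite -{1}[(q ^ k)%N]expn1 leq_pexp2l // expn_gt0; lia.
by rewrite leq_exp2r // /bump_width -expnD subnKC // Nq leq_pexp2l //; lia.
Qed.

Definition bump_form_const : R := 2 * 4 ^+ s + 3 ^+ (2 * s).+1 * (2 * s).+1%:R.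

Lemma bump_form_const_gt0 : 0 < bump_form_const.
Proof.
apply: ltr_wpDr; first by apply: mulr_ge0 => //; exact: exprn_ge0.
by apply: mulr_gt0 => //; exact: exprn_gt0.
Qed.

(** The power sum in the weight of the mean is at least of the order of
    N ^ (2 s + 1), because N <= 3 h. *)
Let mean_coef_le : mean_coef * N%:R ^+ s.+1 * N%:R ^+ s.+1 <= 3 ^+ (2 * s).+1 * (2 * s).+1%:R.
Proof.
have h0 : (0 < h)%N by lia.
have N0 : 0 < N%:R :> R by rewrite ltr0n.
have A0 : 0 < \sum_(a < h) a.+1%:R ^+ (2 * s) :> R.
  case: (h) h0 => // h' _; rewrite big_ord_recl ltr_wpDr ?exprn_gt0 ?ltr0n //.
  by apply: sumr_ge0 => i _; rewrite exprn_ge0.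
have AE : \sum_(a < h) a.+1%:R ^+ (2 * s) = (\sum_(a < h) a.+1 ^ (2 * s))%N%:R :> R.
  by rewrite natr_sum; apply: eq_bigr => a _; rewrite natrX.
rewrite /mean_coef -mulrA -exprD mulrC ler_pdivrMr; last by rewrite mulr_gt0.
have -> : (s.+1 + s.+1 = (2 * s).+1.+1)%N by lia.
rewrite exprS mulrCA ler_pM2l // AE -mulrA -!natrX -!natrM ler_nat.
apply: (@leq_trans ((3 * h) ^ (2 * s).+1)); first by rewrite leq_exp2r //; lia.
by rewrite expnMn leq_mul2l power_sum_ge orbT.
Qed.

(** Summed over the boxes of two levels, the difference part of the form contributes
    only when the levels agree, and the mean part decays geometrically in both
    levels. The sum over all pairs of levels is therefore of the order of the
    number of levels, not of its square. *)
Lemma sum_bump_form_le k k' : (k <= t)%N -> (k' <= t)%N ->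
  \sum_(c < q ^ k) \sum_(c' < q ^ k') bump_form k c k' c' <=
  bump_form_const * ((k == k')%:R + 2 ^- k * 2 ^- k').
Proof.
move=> kt k't.
under eq_bigr => c _ do under eq_bigr => c' _ do rewrite bump_formE ?ltn_ord //.
under eq_bigr => c _ do rewrite big_split /= -mulr_sumr sumr_const card_ord.
rewrite big_split /= -mulr_sumr sumr_const card_ord mulrDr.
have e0 : 0 <= (2 ^- k * 2 ^- k' : R) by rewrite mulr_ge0 // invr_ge0 exprn_ge0.
have N0 : 0 < N%:R :> R by rewrite ltr0n.
apply: lerD.
  apply: (@le_trans _ _ (diff_coef * ((k == k')%:R * (N%:R * 4 ^+ s)))).
    by rewrite ler_wpM2l // (sum_bump_haar_le R s0 sq Nq).
  rewrite mulrCA mulrC ler_wpM2r // /diff_coef.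
  have C1 : 1 <= 'C(2 * s, s)%:R :> R by rewrite ler1n bin_gt0; lia.
  rewrite mulrC ler_pdivrMr; last by rewrite mulr_gt0 // divr_gt0 // (lt_le_trans ltr01 C1).
  have k4 : 0 <= 4 ^+ s :> R by rewrite exprn_ge0.
  have k3 : 0 <= 3 ^+ (2 * s).+1 * (2 * s).+1%:R :> R by rewrite mulr_ge0 // exprn_ge0.
  rewrite /bump_form_const mulrA [N%:R * _]mulrC ler_wpM2r ?(ltW N0) //.
  move: (4 ^+ s) k4 (_ * _%:R) k3 (_%:R) C1 => X X0 T T0 C C1.
  have -> : (2 * X + T) * (C / 2) = X + (X * (C - 1) + T * C / 2) by field.
  by rewrite lerDl addr_ge0 // ?divr_ge0 ?mulr_ge0 // ?subr_ge0 // (le_trans ler01).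
have -> : mean_coef * ((bump_width q t k)%:R ^+ s.+1 * (bump_width q t k')%:R ^+ s.+1) *+ q ^ k' *+ q ^ k
  = mean_coef * ((q ^ k)%:R * (bump_width q t k)%:R ^+ s.+1) * ((q ^ k')%:R * (bump_width q t k')%:R ^+ s.+1).
  by rewrite -mulr_natr -[X in X * _]mulr_natr; ring.
apply: (@le_trans _ _ (mean_coef * (N%:R ^+ s.+1 * 2 ^- k) * (N%:R ^+ s.+1 * 2 ^- k'))).
  apply: ler_pM; rewrite ?level_weight //; do ?by rewrite !mulr_ge0 // exprn_ge0.
  by rewrite ler_wpM2l // level_weight.
have -> : mean_coef * (N%:R ^+ s.+1 * 2 ^- k) * (N%:R ^+ s.+1 * 2 ^- k') =
  mean_coef * N%:R ^+ s.+1 * N%:R ^+ s.+1 * (2 ^- k * 2 ^- k') by ring.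
rewrite ler_wpM2r // (le_trans mean_coef_le) // /bump_form_const lerDr.
by rewrite mulr_ge0 // exprn_ge0.
Qed.

End Form.

(** * A test function that vanishes on a small set *)

Lemma sum_prod_form (R : comPzRingType) (T : finType) (d : nat) (K : T -> T -> R)
    (u v : 'I_d -> T -> R) :
  \sum_(x : {ffun 'I_d -> T}) \sum_(y : {ffun 'I_d -> T})
    (\prod_j u j (x j)) * (\prod_j K (x j) (y j)) * (\prod_j v j (y j)) =
  \prod_j \sum_x \sum_y u j x * K x y * v j y.
Proof.
rewrite bigA_distr_bigA /=; apply: eq_bigr => x _.
rewrite bigA_distr_bigA /=; apply: eq_bigr => y _.
by rewrite !big_split.
Qed.

Lemma sum2_prod (R : comPzRingType) (T : finType) (d : nat) (E : T -> T -> R) :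
  \sum_(f : {ffun 'I_d -> T}) \sum_(g : {ffun 'I_d -> T}) \prod_j E (f j) (g j) =
  (\sum_x \sum_y E x y) ^+ d.
Proof.
under eq_bigr => f _ do rewrite -(bigA_distr_bigA (fun j y => E (f j) y)).
rewrite -(bigA_distr_bigA (fun (j : 'I_d) x => \sum_y E x y)) /=.
by rewrite prodr_const card_ord.
Qed.

Lemma bilinear_sum (R : comPzRingType) (X I : finType) (P : pred I)
    (B : I -> X -> R) (L : X -> X -> R) :
  \sum_x \sum_y (\sum_(i | P i) B i x) * L x y * (\sum_(i | P i) B i y) =
  \sum_(i | P i) \sum_(j | P j) \sum_x \sum_y B i x * L x y * B j y.
Proof.
transitivity (\sum_x \sum_(i | P i) \sum_y \sum_(j | P j) B i x * L x y * B j y).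
  apply: eq_bigr => x _; rewrite exchange_big; apply: eq_bigr => y _ /=.
  rewrite !mulr_suml; apply: eq_bigr => i _; exact: mulr_sumr.
rewrite exchange_big; apply: eq_bigr => i _ /=.
by rewrite [RHS]exchange_big; apply: eq_bigr => x _; rewrite exchange_big.
Qed.

Section TestFunction.
Variables (R : realFieldType) (s q t p d' t0 : nat).
Hypotheses (sq : (s < q)%N) (Nq : p.+2 = (q ^ t.+1)%N).
Hypotheses (d0 : (0 < d')%N) (t00 : (0 < t0)%N) (tE : t = (d' * t0)%N).
Local Notation N := p.+2.
Local Notation d := d'.+1.
Local Notation G := {ffun 'I_d -> 'I_N}.
Local Notation F := {ffun 'I_d' -> 'I_t0}.

(** A shape is given by its levels in all directions but one, chosen freely below
    [t0]; the level in direction [ord0] is the one that makes the total equal to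
    [t]. *)
Definition level (f : F) (j : 'I_d) : nat :=
  if unlift ord0 j is Some i then f i : nat else (t - \sum_i f i)%N.

Lemma level0 f : level f ord0 = (t - \sum_i f i)%N.
Proof. by rewrite /level unlift_none. Qed.

Lemma level_lift f i : level f (lift ord0 i) = f i.
Proof. by rewrite /level liftK. Qed.

Lemma level_le f j : (level f j <= t)%N.
Proof.
case: (unliftP ord0 j) => [i ->|->]; last by rewrite level0 leq_subr.
rewrite level_lift; apply: leq_trans (ltnW (ltn_ord _)) _.
by rewrite tE; nia.
Qed.

Lemma sum_level f : (\sum_j level f j = t)%N.
Proof.
rewrite big_ord_recl level0; rewrite [X in (_ + X)%N](eq_bigr (fun i => f i : nat)); last first.
  by move=> i _; rewrite level_lift.
rewrite subnK // tE -[X in (_ <= X * _)%N]card_ord -sum_nat_const.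
by apply: leq_sum => i _; exact: ltnW.
Qed.

Variable S : {set G}.
Hypothesis Ssmall : (2 * #|S| <= q ^ t)%N.

Definition boxes (f : F) : pred G := family (fun j => [pred c : 'I_N | (c < q ^ level f j)%N]).
Definition box_mem (f : F) (c x : G) : bool :=
  [forall j, (x j %/ (q * bump_width q t (level f j)) == c j)%N].
Definition empty_box (f : F) : pred G :=
  [pred c | (c \in boxes f) && [forall x in S, ~~ box_mem f c x]].

Definition box_bump (f : F) (c x : G) : R :=
  \prod_j (bump R s q t (level f j) (c j))`_(x j).
Definition test_function (x : G) : R := \sum_f \sum_(c | empty_box f c) box_bump f c x.

(** A bump vanishes outside its box, and no box that is used meets [S]. *)
Lemma test_vanish x : x \in S -> test_function x = 0.
Proof.
move=> xS; rewrite /test_function big1 // => f _; rewrite big1 // => c /andP[_ /forall_inP/(_ x xS)].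
rewrite negb_forall => /existsP[j xj].
by rewrite /box_bump (bigD1 j) //= (bump_support R sq) ?mul0r.
Qed.

Let boxesP f c j : c \in boxes f -> (c j < q ^ level f j)%N.
Proof. by move=> /familyP/(_ j). Qed.

Let q0 : (0 < q)%N. Proof. exact: leq_ltn_trans sq. Qed.

Let box_le_N f j : (q ^ level f j <= N)%N.
Proof. by rewrite Nq leq_pexp2l // (leq_trans (level_le f j)). Qed.

(** Sums over the boxes of a shape factor over the directions. *)
Lemma sum_boxes f (E : 'I_d -> nat -> R) :
  \sum_(c in boxes f) \prod_j E j (c j) = \prod_j \sum_(c < q ^ level f j) E j c.
Proof.
rewrite -(bigA_distr_big_dep _ (fun j (c : 'I_N) => E j c)).
by apply: eq_bigr => j _; rewrite (big_ord_widen N) // box_le_N.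
Qed.

Lemma card_boxes f : (#|boxes f| = q ^ t)%N.
Proof.
have := sum_boxes f (fun _ _ => 1).
rewrite [LHS](eq_bigr (fun=> 1)); last by move=> c _; rewrite big1.
rewrite [RHS](eq_bigr (fun j => (q ^ level f j)%:R)); last first.
  by move=> j _; rewrite sumr_const card_ord.
rewrite -natr_prod -expn_sum sum_level sumr_const => /eqP.
by rewrite eqr_nat => /eqP.
Qed.

(** There are q ^ t boxes of each shape, each point of [S] lies in one of them, and
    [S] has at most half as many points. *)
Lemma card_empty_box f : (q ^ t <= 2 * #|empty_box f|)%N.
Proof.
(* The position of the box of shape [f] that contains a given point. *)
pose cell (x : G) : G := [ffun j => inord (x j %/ (q * bump_width q t (level f j)))].
have sub : boxes f \subset [predU empty_box f & cell @: S].
  apply/fintype.subsetP => c cb; apply/orP; have [gc|ngc] := boolP (empty_box f c); [by left|right].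
  case/nandP: ngc => [/negP[]//|].
  rewrite negb_forall_in => /exists_inP[x xS /negPn/forallP hx].
  apply/imsetP; exists x => //; apply/ffunP => j; rewrite ffunE (eqP (hx j)).
  by apply/val_inj; rewrite /= inordK.
have := subset_leq_card sub; rewrite card_boxes => h1.
have h2 : (#|[predU empty_box f & cell @: S]| <= #|empty_box f| + #|S|)%N.
  apply: (@leq_trans (#|empty_box f| + #|cell @: S|)); last first.
    by rewrite leq_add2l leq_imset_card.
  by rewrite -cardUI leq_addr.
move: (leq_trans h1 h2) Ssmall; clear; move: #|empty_box f| #|S| (q ^ t)%N => a b c; lia.
Qed.

Lemma sum_bump k c : (k <= t)%N -> (c < q ^ k)%N ->
  \sum_(x < N) (bump R s q t k c)`_x = (bump_width q t k)%:R ^+ s.+1.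
Proof.
by move=> kt ck; rewrite -horner1_coef ?(size_bump R sq Nq) // bspline1.
Qed.

(** There are t0 ^ d' shapes, each with at least q ^ t / 2 boxes free of [S], and
    the mass of a bump is the same for all shapes since the widths of a box have
    a fixed product. *)
Lemma sum_test_ge :
  t0%:R ^+ d' * ((q ^ t)%:R / 2) * (q ^ (t * d'))%:R ^+ s.+1 <= \sum_x test_function x.
Proof.
have -> : \sum_x test_function x =
    \sum_f \sum_(c | empty_box f c) \prod_j (bump_width q t (level f j))%:R ^+ s.+1.
  rewrite exchange_big /=; apply: eq_bigr => f _.
  rewrite exchange_big /=; apply: eq_bigr => c /andP[cb _].
  rewrite -(bigA_distr_bigA (fun j x => (bump R s q t (level f j) (c j))`_(x : 'I_N))).
  by apply: eq_bigr => j _; rewrite sum_bump ?level_le // boxesP.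
have w f : \prod_j (bump_width q t (level f j))%:R ^+ s.+1 = (q ^ (t * d'))%:R ^+ s.+1 :> R.
  rewrite prodrXl -natr_prod -expn_sum; congr ((q ^ _)%:R ^+ _).
  rewrite sumnB => [|j _]; last exact: level_le.
  by rewrite sum_level sum_nat_const card_ord; nia.
rewrite (eq_bigr (fun f => (q ^ (t * d'))%:R ^+ s.+1 *+ #|empty_box f|)); last first.
  by move=> f _; rewrite -sumr_const; apply: eq_bigr => c _; exact: w.
have -> : t0%:R ^+ d' = #|F|%:R :> R by rewrite card_ffun !card_ord natrX.
rewrite -mulrA [X in X <= _]mulr_natl.
have -> (x : R) : x *+ #|F| = \sum_(f : F) x by rewrite sumr_const; congr (_ *+ _).
apply: ler_sum => f _.
rewrite -[X in _ <= X]mulr_natl ler_wpM2r ?exprn_ge0 //.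
by rewrite ler_pdivrMr // -natrM ler_nat mulnC card_empty_box.
Qed.

Variable h : nat.
Hypotheses (s0 : (0 < s)%N) (Nh : p.+2 = (2 * h).+1).

Definition test_const : R := 2 * bump_form_const R s ^+ d * 5 ^+ d'.

Lemma test_const_gt0 : 0 < test_const.
Proof.
apply: mulr_gt0; last exact: exprn_gt0.
by apply: mulr_gt0 => //; apply: exprn_gt0; exact: bump_form_const_gt0.
Qed.

(** The number of shapes is t0 ^ d', and up to a constant the form is no larger.
    After bounding the factor of direction [ord0] by 2, the levels in the other
    directions are independent, and the double sum over shapes is a d'-th power
    of a sum over two levels of (Kronecker delta + a convergent term). *)
Lemma test_form_le :
  \sum_x \sum_(y : G) test_function x * (\prod_j mean_inverse R p s h (x j) (y j)) * test_function y <=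
  test_const * t0%:R ^+ d'.
Proof.
(* Expand over pairs (shape, position), then enlarge the range to all boxes. *)
pose P (i : F * G) := empty_box i.1 i.2.
have testE x : test_function x = \sum_(i | P i) box_bump i.1 i.2 x.
  by rewrite /test_function pair_big_dep.
under eq_bigr => x _ do under eq_bigr => y _ do rewrite !testE.
rewrite bilinear_sum.
pose fm (i j : F * G) :=
  \prod_l bump_form R s q t p h (level i.1 l) (i.2 l) (level j.1 l) (j.2 l).
rewrite (eq_bigr (fun i => \sum_(j | P j) fm i j)); last first.
  move=> i _; apply: eq_bigr => j _; rewrite /box_bump /fm.
  exact: (sum_prod_form (mean_inverse R p s h)
    (fun l x => (bump R s q t (level i.1 l) (i.2 l))`_x)
    (fun l x => (bump R s q t (level j.1 l) (j.2 l))`_x)).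
have fm0 i j : i.2 \in boxes i.1 -> j.2 \in boxes j.1 -> 0 <= fm i j.
  move=> ib jb; apply: prodr_ge0 => l _.
  by apply: bump_form_ge0; rewrite ?level_le ?boxesP.
pose Q (i : F * G) := i.2 \in boxes i.1.
apply: (@le_trans _ _ (\sum_(i | Q i) \sum_(j | Q j) fm i j)).
  have PQ i : P i -> Q i by case/andP.
  apply: (@le_trans _ _ (\sum_(i | P i) \sum_(j | Q j) fm i j)).
    apply: ler_sum => i Pi; rewrite [X in _ <= X](bigID P) /=.
    rewrite (eq_bigl P) => [|j]; last by case Pj: (P j); rewrite ?andbF // (PQ _ Pj).
    by rewrite lerDl sumr_ge0 // => j /andP[Qj _]; rewrite fm0 //; exact: PQ.
  rewrite [X in _ <= X](bigID P) /=.
  rewrite [X in _ <= X + _](eq_bigl P) => [|j]; last by case Pj: (P j); rewrite ?andbF // (PQ _ Pj).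
  rewrite lerDl sumr_ge0 // => i /andP[Qi _]; rewrite sumr_ge0 // => j Qj.
  exact: fm0.
have -> : \sum_(i | Q i) \sum_(j | Q j) fm i j = \sum_f \sum_g \prod_l
    \sum_(c < q ^ level f l) \sum_(e < q ^ level g l) bump_form R s q t p h (level f l) c (level g l) e.
  rewrite -(pair_big_dep xpredT (fun f c => c \in boxes f)
    (fun f c => \sum_(j | Q j) fm (f, c) j)) /=.
  apply: eq_bigr => f _.
  rewrite (eq_bigr (fun c => \sum_g \sum_(e in boxes g) fm (f, c) (g, e))); last first.
    by move=> c _; rewrite -(pair_big_dep xpredT (fun f c => c \in boxes f)
      (fun g e => fm (f, c) (g, e))).
  rewrite exchange_big /=; apply: eq_bigr => g _.
  rewrite -(sum_boxes f (fun l c => \sum_(e < q ^ level g l)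
    bump_form R s q t p h (level f l) c (level g l) e)).
  apply: eq_bigr => c _.
  exact: (sum_boxes g (fun l e => bump_form R s q t p h (level f l) (c l) (level g l) e)).
(* From here on only the levels matter. *)
pose E (a b : nat) : R := (a == b)%:R + 2 ^- a * 2 ^- b.
have E0 a b : 0 <= E a b.
  by rewrite addr_ge0 ?ler0n // mulr_ge0 // invr_ge0 exprn_ge0.
have K0 : 0 <= bump_form_const R s.
  exact: ltW (bump_form_const_gt0 _ _).
apply: (@le_trans _ _ (\sum_f \sum_g \prod_(l < d) (bump_form_const R s * E (level f l) (level g l)))).
  apply: ler_sum => f _; apply: ler_sum => g _; apply: ler_prod => l _.
  rewrite sum_bump_form_le ?level_le // andbT.
  rewrite sumr_ge0 // => c _; rewrite sumr_ge0 // => e _.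
  by apply: bump_form_ge0; rewrite ?level_le ?ltn_ord.
apply: (@le_trans _ _ (\sum_(f : F) \sum_(g : F)
    (2 * bump_form_const R s ^+ d) * \prod_(l < d') E (f l) (g l))).
  apply: ler_sum => f _; apply: ler_sum => g _.
  rewrite big_split /= prodr_const card_ord big_ord_recl.
  rewrite [2 * _]mulrC -[X in _ <= X]mulrA ler_wpM2l ?exprn_ge0 //.
  rewrite (eq_bigr (fun l => E (f l) (g l))) => [|l _]; last by rewrite !level_lift.
  rewrite ler_wpM2r ?prodr_ge0 // /E -[2 in leRHS]/(1 + 1) lerD //.
    by case: eqP.
  by rewrite mulr_ile1 ?invr_ge0 ?exprn_ge0 // invf_le1 ?exprn_gt0 // exprn_ege1 // ler1n.
under eq_bigr => f _ do rewrite -mulr_sumr.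
rewrite -mulr_sumr (sum2_prod d' (fun a b : 'I_t0 => E a b)) /test_const -[X in _ <= X]mulrA.
rewrite ler_wpM2l ?mulr_ge0 ?exprn_ge0 // -exprMn lerXn2r ?nnegrE ?mulr_ge0 //.
  by apply: sumr_ge0 => a _; apply: sumr_ge0.
(* The convergent term contributes at most 4 in total, and t0 + 4 <= 5 t0. *)
have geo : \sum_(a < t0) 2 ^- a <= 2 :> R.
  have : \sum_(a < t0) 2 ^- a = 2 - 2 * 2 ^- t0 :> R.
    elim: (t0) => [|n IH]; first by rewrite big_ord0 expr0 invr1 mulr1 subrr.
    rewrite big_ord_recr /= IH exprS invfM; move: (2 ^- n) => x; by field.
  by move=> ->; rewrite lerBlDr lerDl mulr_ge0 // invr_ge0 exprn_ge0.
have -> : \sum_(a < t0) \sum_(b < t0) E a b =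
    t0%:R + (\sum_(a < t0) 2 ^- a) * (\sum_(b < t0) 2 ^- b).
  under eq_bigr => a _ do rewrite big_split /=.
  rewrite big_split /=; congr (_ + _).
    rewrite (eq_bigr (fun=> 1)) ?sumr_const ?card_ord // => a _.
    rewrite (bigD1 a) //= eqxx big1 ?addr0 // => b ba.
    by rewrite -[(a == b :> nat)%N]/(a == b) eq_sym (negPf ba).
  by rewrite mulr_suml; apply: eq_bigr => a _; rewrite mulr_sumr.
set g := \sum_(a < t0) 2 ^- a; have g0 : 0 <= g.
  by apply: sumr_ge0 => a _; rewrite invr_ge0 exprn_ge0.
have gg : g * g <= 2 * 2 by apply: ler_pM.
have : 1 <= t0%:R :> R by rewrite ler1n.
by move: gg; rewrite -/g; move: (g * g) (t0%:R) => x y; lra.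
Qed.

End TestFunction.

(** * A lower bound for signed measures on the grid *)

Section CyclicLowerBound.
Variables (R : realFieldType) (s q t p h d' t0 : nat).
Hypotheses (s0 : (0 < s)%N) (sq : (s < q)%N) (Nq : p.+2 = (q ^ t.+1)%N).
Hypothesis Nh : p.+2 = (2 * h).+1.
Hypothesis cops : forall k, (0 < k <= s)%N -> coprime p.+2 k.
Hypotheses (d0 : (0 < d')%N) (t00 : (0 < t0)%N) (tE : t = (d' * t0)%N).
Local Notation N := p.+2.
Local Notation d := d'.+1.
Local Notation G := {ffun 'I_d -> 'I_N}.
Variables (S : {set G}) (nu : G -> R) (theta eps : R).
Hypothesis Ssmall : (2 * #|S| <= q ^ t)%N.
Hypothesis theta0 : 0 <= theta.
Hypothesis nuS : forall x, x \notin S -> nu x = theta.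
Hypothesis nu_eps : forall (z : G) (a : {ffun 'I_d -> 'I_h}),
  `|\sum_(x : G) nu x * \prod_j box_kernel R p s (a j).+1 (z j) (x j)| <= eps.

(** The energy for the averaged kernel is the integral against [nu] of the errors
    summed over all widths, each of which is at most [eps]. *)
Lemma cyclic_energy_le :
  \sum_(z : G) \sum_(x : G) nu z * (\prod_j mean_kernel R p s h (z j) (x j)) * nu x <=
  h%:R ^+ d * eps * \sum_x `|nu x|.
Proof.
rewrite mulr_sumr; apply: ler_sum => z _.
have -> : \sum_(x : G) nu z * (\prod_j mean_kernel R p s h (z j) (x j)) * nu x =
    nu z * \sum_(a : {ffun 'I_d -> 'I_h})
      \sum_(x : G) nu x * \prod_j box_kernel R p s (a j).+1 (z j) (x j).
  rewrite exchange_big mulr_sumr; apply: eq_bigr => x _ /=.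
  rewrite -mulrA; congr (_ * _); rewrite mulrC -mulr_sumr; congr (_ * _).
  rewrite -(bigA_distr_bigA (fun j (a : 'I_h) => box_kernel R p s a.+1 (z j) (x j))).
  by apply: eq_bigr => j _; rewrite /mean_kernel summxE.
rewrite (le_trans (ler_norm _)) // normrM mulrC ler_wpM2r //.
rewrite (le_trans (ler_norm_sum _ _ _)) //.
apply: (@le_trans _ _ (\sum_(a : {ffun 'I_d -> 'I_h}) eps)).
  by apply: ler_sum => a _; exact: nu_eps.
by rewrite sumr_const card_ffun !card_ord -natrX mulr_natl.
Qed.

(** [theta] is the density of the uniform part of [nu]; off [S] there is nothing
    else, so pairing [nu] with the test function gives [theta] times its sum. *)
Lemma cyclic_lower_bound :
  (theta * (t0%:R ^+ d' * ((q ^ t)%:R / 2) * (q ^ (t * d'))%:R ^+ s.+1)) ^+ 2 <=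
  test_const R s d' * t0%:R ^+ d' * (h%:R ^+ d * eps * \sum_x `|nu x|).
Proof.
have tc0 : 0 < test_const R s d' * t0%:R ^+ d'.
  by rewrite mulr_gt0 ?test_const_gt0 // exprn_gt0 // ltr0n.
pose psi := @test_function R s q t p d' t0 S.
have kv x y : mean_kernel R p s h x y = \sum_(u : 'I_h * 'I_N)
    horner_mx (cyclic_shift R p) (spline_power R s u.1.+1) x u.2 *
    horner_mx (cyclic_shift R p) (spline_power R s u.1.+1) y u.2.
  rewrite /mean_kernel summxE.
  rewrite -(pair_big xpredT xpredT (fun (a : 'I_h) (w : 'I_N) =>
    horner_mx (cyclic_shift R p) (spline_power R s a.+1) x w *
    horner_mx (cyclic_shift R p) (spline_power R s a.+1) y w)) /=.
  apply: eq_bigr => a _; rewrite /box_kernel mxE; apply: eq_bigr => w _.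
  by congr (_ * _); rewrite mxE.
have kl x y : \sum_z mean_kernel R p s h x z * mean_inverse R p s h z y = (x == y)%:R.
  by have /matrixP/(_ x y) := mean_kernel_inverse R cops s0 Nh; rewrite !mxE.
have dual := tensor_duality nu kv kl tc0 (test_form_le R sq Nq d0 t00 tE S s0 Nh).
apply: le_trans (le_trans dual _); last by rewrite ler_wpM2l ?(ltW tc0) // cyclic_energy_le.
have -> : \sum_x nu x * psi x = theta * \sum_x psi x.
  rewrite mulr_sumr; apply: eq_bigr => x _.
  have [xS|xS] := boolP (x \in S); last by rewrite nuS.
  by rewrite /psi (test_vanish R t t0 sq xS) !mulr0.
have ge0 : 0 <= t0%:R ^+ d' * ((q ^ t)%:R / 2) * (q ^ (t * d'))%:R ^+ s.+1 :> R.
  by rewrite !mulr_ge0 ?exprn_ge0 ?invr_ge0.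
have le := sum_test_ge R sq Nq d0 t00 tE Ssmall.
apply: lerXn2r; rewrite ?nnegrE; [exact: mulr_ge0| |exact: ler_wpM2l].
by apply: mulr_ge0 => //; exact: le_trans ge0 le.
Qed.

End CyclicLowerBound.

(** * Integrals of truncated powers *)

Section PolynomialIntegral.
Local Open Scope classical_set_scope.
Local Open Scope ring_scope.
Context (R : realType).
Local Notation mu := (@lebesgue_measure R).

Lemma integrable_horner (p : {poly R}) (a b : R) :
  mu.-integrable `[a, b] (EFin \o (fun x => p.[x])).
Proof.
apply: continuous_compact_integrable; first exact: segment_compact.
by apply: continuous_subspaceT => x; exact: continuous_horner.
Qed.

Lemma Rintegral_deriv (p : {poly R}) (a b : R) : a <= b ->
  \int[mu]_(x in `[a, b]) (p^`()).[x] = p.[b] - p.[a].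
Proof.
rewrite le_eqVlt => /predU1P[->|ab].
  by rewrite set_itv1 Rintegral_set1 subrr.
rewrite /Rintegral (@continuous_FTC2 R (horner p^`()) (horner p)) //.
- by apply: continuous_subspaceT => x; exact: continuous_horner.
- split => [x _||]; first exact: derivable_horner.
  + by apply: cvg_at_right_filter; exact: continuous_horner.
  + by apply: cvg_at_left_filter; exact: continuous_horner.
- by move=> x _; rewrite -derivE.
Qed.


(** The value at 0 matters for k = 0, where this is the indicator of the closed
    half-line; it matches the half-open interval in [hat1]. *)
Definition truncated_power (k : nat) (y : R) : R :=
  if 0 <= y then y ^+ k / k`!%:R else 0.

Lemma truncated_power_ge0E k y : 0 <= y -> truncated_power k y = y ^+ k / k`!%:R.
Proof. by rewrite /truncated_power => ->. Qed.

Lemma truncated_power_lt0 k y : y < 0 -> truncated_power k y = 0.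
Proof. by rewrite /truncated_power leNgt => ->. Qed.

Lemma measurable_horner (p : {poly R}) : measurable_fun [set: R] (horner p).
Proof. by apply: continuous_measurable_fun; exact: continuous_horner. Qed.

Lemma measurable_truncated_power k : measurable_fun [set: R] (truncated_power k).
Proof.
have -> : truncated_power k =
    (fun y => \1_(`[0, +oo[%classic : set R) y * ('X^k * (k`!%:R^-1)%:P).[y]).
  apply/funext => y; rewrite /truncated_power indicE hornerM hornerXn hornerC.
  by rewrite mem_setE in_itv /= andbT; case: ifP; rewrite ?mul1r ?mul0r.
apply: measurable_funM; last exact: measurable_horner.
by apply: measurable_indic; exact: measurable_itv.
Qed.

Let affine_power (k : nat) (c e : R) : {poly R} := (k`!%:R)^-1 *: (c%:P + e *: 'X) ^+ k.

Let affine_powerE k c e y : (affine_power k c e).[y] = (c + e * y) ^+ k / k`!%:R.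
Proof. by rewrite hornerZ horner_exp hornerD hornerZ hornerC hornerX mulrC. Qed.

Let deriv_affine_power k c e : e * e = 1 ->
  (e *: affine_power k.+1 c e)^`() = affine_power k c e.
Proof.
move=> ee; rewrite /affine_power !derivZ deriv_exp derivD derivC derivZ derivX add0r.
rewrite -[_ *+ k.+1]scaler_nat -scalerAl mul1r !scalerA; congr (_ *: _).
rewrite factS natrM invfM mulrA.
have : k.+1%:R != 0 :> R by rewrite pnatr_eq0.
have : k`!%:R != 0 :> R by rewrite pnatr_eq0 -lt0n fact_gt0.
move: (k`!%:R) (k.+1%:R) => x y x0 y0.
transitivity ((e * e) * x^-1); [by field; rewrite x0 y0 | by rewrite ee mul1r].
Qed.

(** The sign [e] = 1 or -1 treats translations and reflections together. *)
Let affine_int k c e (i : interval R) a b : e * e = 1 -> a <= b ->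
  i = Interval (BLeft a) (BLeft b) \/ i = Interval (BLeft a) (BRight b) ->
  \int[mu]_(y in [set` i]) ((c + e * y) ^+ k / k`!%:R) =
  e * ((c + e * b) ^+ k.+1 / (k.+1)`!%:R) - e * ((c + e * a) ^+ k.+1 / (k.+1)`!%:R).
Proof.
move=> ee ab ib; transitivity (\int[mu]_(y in [set` i]) (affine_power k c e).[y]).
  by apply: eq_Rintegral => y _; rewrite affine_powerE.
have -> : \int[mu]_(y in [set` i]) (affine_power k c e).[y] =
   \int[mu]_(y in `[a, b]) (affine_power k c e).[y].
  case: ib => -> //; rewrite Rintegral_itv_bndo_bndc //.
  apply: (@integrableS _ _ _ mu `[a, b]) => //; last exact: integrable_horner.
  by apply: subset_itvl; rewrite bnd_simp.
by rewrite -deriv_affine_power // Rintegral_deriv // [_.[b]]hornerZ [_.[a]]hornerZ !affine_powerE.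
Qed.

Let integrable_tp k c e a b :
  mu.-integrable `[a, b[ (EFin \o (fun y => truncated_power k (c + e * y))).
Proof.
apply: (@le_integrable _ _ _ mu _ _ _ (EFin \o (fun y => (affine_power k c e).[y]))) => //.
- apply/measurable_EFinP; apply: measurable_funTS.
  apply: (measurableT_comp (measurable_truncated_power k)).
  rewrite (_ : (fun y => _) = horner (c%:P + e *: 'X)); first exact: measurable_horner.
  by apply/funext => y; rewrite hornerD hornerZ hornerC hornerX.
- move=> y _ /=; rewrite lee_fin /truncated_power affine_powerE.
  by case: ifP => // _; rewrite normr0.
- apply: (@integrableS _ _ _ mu `[a, b]) => //; last exact: integrable_horner.
  by apply: subset_itvl; rewrite bnd_simp.
Qed.

Let tp_itv k c e a b (i : interval R) :
  (forall y, y \in `[a, b[ -> (0 <= c + e * y) = (y \in i)) -> [set` i] `<=` `[a, b[ ->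
  \int[mu]_(y in `[a, b[) truncated_power k (c + e * y) =
  \int[mu]_(y in [set` i]) ((c + e * y) ^+ k / k`!%:R).
Proof.
move=> ci iab; rewrite -[in RHS](setIidr iab) Rintegral_mkcondr.
apply: eq_Rintegral => y; rewrite inE /= => yab.
by rewrite /truncated_power ci // patchE mem_setE.
Qed.

Lemma integral_truncated_power k c a b : a <= b ->
  mu.-integrable `[a, b[ (EFin \o (fun y => truncated_power k (y + c))) /\
  \int[mu]_(y in `[a, b[) truncated_power k (y + c) =
  truncated_power k.+1 (b + c) - truncated_power k.+1 (a + c).
Proof.
move=> ab.
have -> : (fun y => truncated_power k (y + c)) = (fun y => truncated_power k (c + 1 * y)).
  by apply/funext => y; rewrite mul1r addrC.
split; first exact: integrable_tp.
have e1 : 1 * 1 = 1 :> R by rewrite mulr1.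
have [ac|ac] := leP (- c) a.
  rewrite (@tp_itv k c 1 a b `[a, b[) => [|y|]//; last first.
    rewrite in_itv /= => /andP[h1 h2]; rewrite h1 h2 /=.
    by have -> : 0 <= c + 1 * y by lra.
  rewrite (affine_int _ _ e1 ab) ?mul1r; last by left.
  by rewrite !truncated_power_ge0E ?[_ + c]addrC //; lra.
have [bc|bc] := leP (- c) b.
  rewrite (@tp_itv k c 1 a b `[- c, b[) => [|y|]; last 2 first.
  - rewrite !in_itv /= => /andP[h1 h2]; rewrite h2 andbT; apply/idP/idP; lra.
  - by apply: subset_itvr; rewrite bnd_simp ltW.
  rewrite (affine_int _ _ e1 bc) ?mul1r; last by left.
  rewrite subrr expr0n mul0r subr0 truncated_power_ge0E 1?addrC; last by lra.
  by rewrite [X in _ - X]truncated_power_lt0 ?subr0 1?addrC //; lra.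
rewrite (@tp_itv k c 1 a b `]0, 0[) => [|y|]; last 2 first.
- by rewrite !in_itv /= => /andP[h1 h2]; rewrite lt_asym leNgt; apply/negbF; lra.
- by rewrite set_itvoo0.
rewrite set_itvoo0 Rintegral_set0 !truncated_power_lt0 ?subr0 //; lra.
Qed.

(** The reflected form, as it occurs in a convolution. *)
Lemma integral_truncated_power_opp k x a b : a <= b ->
  mu.-integrable `[a, b[ (EFin \o (fun y => truncated_power k (x - y))) /\
  \int[mu]_(y in `[a, b[) truncated_power k (x - y) =
  truncated_power k.+1 (x - a) - truncated_power k.+1 (x - b).
Proof.
move=> ab.
have -> : (fun y => truncated_power k (x - y)) = (fun y => truncated_power k (x + (-1) * y)).
  by apply/funext => y; rewrite mulN1r.
split; first exact: integrable_tp.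
have e1 : (-1) * (-1) = 1 :> R by rewrite mulrNN mulr1.
have [bx|bx] := leP b x.
  rewrite (@tp_itv k x (-1) a b `[a, b[) => [|y|]//; last first.
    rewrite in_itv /= => /andP[h1 h2]; rewrite h1 h2 /=.
    by have -> : 0 <= x + -1 * y by lra.
  rewrite (affine_int _ _ e1 ab) ?mulN1r; last by left.
  by rewrite opprK addrC !truncated_power_ge0E ?mulN1r //; lra.
have [ax|ax] := leP a x.
  rewrite (@tp_itv k x (-1) a b `[a, x]) => [|y|]; last 2 first.
  - rewrite !in_itv /= => /andP[h1 h2]; rewrite h1; apply/idP/idP; lra.
  - by apply: subset_itvl; rewrite bnd_simp.
  rewrite (affine_int _ _ e1 ax) ?mulN1r; last by right.
  rewrite subrr expr0n mul0r oppr0 sub0r opprK  truncated_power_ge0E; last by lra.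
  by rewrite truncated_power_lt0 ?subr0 //; lra.
rewrite (@tp_itv k x (-1) a b `]0, 0[) => [|y|]; last 2 first.
- by rewrite !in_itv /= => /andP[h1 h2]; rewrite lt_asym leNgt; apply/negbF; lra.
- by rewrite set_itvoo0.
rewrite set_itvoo0 Rintegral_set0 !truncated_power_lt0 ?subr0 //; lra.
Qed.

End PolynomialIntegral.

(** * Hat functions as differences of truncated powers *)

Section HatFormula.
Local Open Scope classical_set_scope.
Local Open Scope ring_scope.
Context (R : realType).
Local Notation mu := (@lebesgue_measure R).

Definition central_diff (u : R) (f : R -> R) (x : R) : R := f (x + u / 2) - f (x - u / 2).

(** The truncated power of degree [r], differenced only [r] times: a smooth step
    from 0 to [u ^ r], of which the hat of order r + 1 is one more difference. *)
Definition spline_step (r : nat) (u : R) : R -> R :=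
  iter r (central_diff u) (@truncated_power R r).

(** [g] is [u] times the moving average of [f] over windows of width [u], with
    integrability included so that the relation passes to differences. *)
Definition averages (u : R) (f g : R -> R) : Prop := forall x,
  mu.-integrable `[- (u / 2), u / 2[ (EFin \o (fun y => f (x - y))) /\
  \int[mu]_(y in `[- (u / 2), u / 2[) f (x - y) = g x.

Lemma averages_central_diff u v f g :
  averages u f g -> averages u (central_diff v f) (central_diff v g).
Proof.
move=> fg x; have [i1 e1] := fg (x + v / 2); have [i2 e2] := fg (x - v / 2).
have shift y : central_diff v f (x - y) = f (x + v / 2 - y) - f (x - v / 2 - y).
  by rewrite /central_diff; congr (f _ - f _); ring.
split.
  rewrite (_ : _ \o _ = (fun y => (f (x + v / 2 - y))%:E - (f (x - v / 2 - y))%:E)%E).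
    by apply: integrableB.
  by apply/funext => y /=; rewrite shift EFinB.
rewrite /central_diff -e1 -e2 -RintegralB //.
by apply: eq_Rintegral => y _; exact: shift.
Qed.

Lemma averages_spline_step r u : 0 <= u ->
  averages u (spline_step r u) (spline_step r.+1 u).
Proof.
move=> u0.
have base : averages u (@truncated_power R r) (central_diff u (@truncated_power R r.+1)).
  move=> x; have ab : - (u / 2) <= u / 2 by lra.
  by have [i e] := integral_truncated_power_opp r x ab; rewrite e opprK.
rewrite /spline_step iterSr; elim: {1 3}r => [|n IH] //=.
exact: averages_central_diff.
Qed.

Lemma convolution_hat1 f (u x : R) :
  convolution f (hat1 u) x = \int[mu]_(y in `[- (u / 2), u / 2[) f (x - y).
Proof.
rewrite /convolution [RHS]Rintegral_mkcond; apply: eq_Rintegral => y _.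
rewrite /hat1 indicE patchE !mem_setE.
by case: (y \in _); rewrite ?mulr1 ?mulr0.
Qed.

(** Convolution with [hat1 u] integrates over a window of width [u], so it replaces
    a truncated power by the central difference of the next one. *)
Lemma hatE (r : nat) (u : R) : 0 < u -> hat r.+1 u = central_diff u (spline_step r u).
Proof.
move=> u0; elim: r => [|r IH].
  apply/funext => x; rewrite /hat /hat1 /central_diff /spline_step /= indicE.
  rewrite mem_setE in_itv /=.
  have [h1|h1] := leP 0 (x + u / 2); last first.
    rewrite !truncated_power_lt0 ?subr0; last by lra.
      by have -> : (- (u / 2) <= x) = false by apply/negbTE; rewrite -ltNge; lra.
    by lra.
  have -> : - (u / 2) <= x by lra.
  rewrite truncated_power_ge0E // expr0 fact0 divr1.
  have [h2|h2] := ltP x (u / 2).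
    by rewrite truncated_power_lt0 ?subr0 //; lra.
  by rewrite truncated_power_ge0E ?expr0 ?fact0 ?divr1 ?subrr //; lra.
rewrite [LHS]/(convolution (hat r.+1 u) (hat1 u)) IH; apply/funext => x.
rewrite -[LHS]/(convolution (central_diff u (spline_step r u)) (hat1 u) x) convolution_hat1.
by have [_ ->] := averages_central_diff u (averages_spline_step r (ltW u0)) x.
Qed.

Lemma hat_ge0 (r : nat) (u x : R) : 0 <= hat r u x.
Proof.
have h1 y : 0 <= hat1 u y by rewrite /hat1 indicE ler0n.
elim: r x => [|r IH] x //.
case: r IH => [|r] IH; first exact: h1.
by apply: Rintegral_ge0 => y _; rewrite mulr_ge0.
Qed.

Lemma spline_step_left r (u x : R) : 0 < u -> x < - (r%:R * u / 2) -> spline_step r u x = 0.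
Proof.
move=> u0; elim: r x => [|r IH] x xr.
  by rewrite /spline_step /= truncated_power_lt0 //; lra.
have [_ <-] := averages_spline_step r (ltW u0) x.
rewrite (_ : 0 = \int[mu]_(y in `[- (u / 2), u / 2[) (cst 0 y)); last first.
  by rewrite Rintegral_cst ?mul0r //; exact: measurable_itv.
apply: eq_Rintegral => y; rewrite inE /= in_itv /= => /andP[h1 h2].
by rewrite IH //; move: xr; rewrite -natr1; lra.
Qed.

(** By induction: far to the right the window only sees the constant [u ^ r]. *)
Lemma spline_step_right r (u x : R) : 0 < u -> r%:R * u / 2 <= x ->
  spline_step r u x = u ^+ r.
Proof.
move=> u0; elim: r x => [|r IH] x xr.
  by rewrite /spline_step /= truncated_power_ge0E ?expr0 ?fact0 ?divr1 //; lra.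
have [_ <-] := averages_spline_step r (ltW u0) x.
rewrite (_ : u ^+ r.+1 = \int[mu]_(y in `[- (u / 2), u / 2[) (cst (u ^+ r) y)); last first.
  rewrite Rintegral_cst; last exact: measurable_itv.
  rewrite [X in fine X](lebesgue_measure_itv (Interval (BLeft (- (u / 2))) (BLeft (u / 2)))) /= lte_fin.
  have -> : - (u / 2) < u / 2 by lra.
  by rewrite /= exprSr; congr (_ * _); field.
apply: eq_Rintegral => y; rewrite inE /= in_itv /= => /andP[h1 h2].
by rewrite IH //; move: xr; rewrite -natr1; lra.
Qed.

(** Both values of the step coincide. *)
Lemma hat_left r (u x : R) : 0 < u -> x < - (r.+1%:R * u / 2) -> hat r.+1 u x = 0.
Proof.
move=> u0; rewrite -natr1 => h; rewrite hatE // /central_diff.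
by rewrite !spline_step_left ?subrr //; lra.
Qed.

Lemma hat_right r (u x : R) : 0 < u -> r.+1%:R * u / 2 <= x -> hat r.+1 u x = 0.
Proof.
move=> u0; rewrite -natr1 => h; rewrite hatE // /central_diff.
by rewrite !spline_step_right ?subrr //; lra.
Qed.

Lemma measurable_hat r (u : R) : 0 < u -> measurable_fun [set: R] (hat r.+1 u).
Proof.
move=> u0; rewrite hatE // -[central_diff u _]/(iter r.+1 (central_diff u) _).
elim: r.+1 => [|n IH] /=; first exact: measurable_truncated_power.
apply: measurable_funB; apply: (measurableT_comp IH).
  exact: measurable_funD.
exact: measurable_funB.
Qed.

Definition primitive_of (f g : R -> R) : Prop := forall c a b, a <= b ->
  mu.-integrable `[a, b[ (EFin \o (fun y => f (y + c))) /\
  \int[mu]_(y in `[a, b[) f (y + c) = g (b + c) - g (a + c).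

Lemma primitive_central_diff v f g :
  primitive_of f g -> primitive_of (central_diff v f) (central_diff v g).
Proof.
move=> fg c a b ab.
have [i1 e1] := fg (c + v / 2) _ _ ab; have [i2 e2] := fg (c - v / 2) _ _ ab.
have shift y : central_diff v f (y + c) = f (y + (c + v / 2)) - f (y + (c - v / 2)).
  by rewrite /central_diff !addrA.
split.
  rewrite (_ : _ \o _ =
      (fun y => (f (y + (c + v / 2)))%:E - (f (y + (c - v / 2)))%:E)%E).
    by apply: integrableB.
  by apply/funext => y /=; rewrite shift EFinB.
transitivity (g (b + (c + v / 2)) - g (a + (c + v / 2)) -
             (g (b + (c - v / 2)) - g (a + (c - v / 2)))).
  rewrite -e1 -e2 -RintegralB //.
  by apply: eq_Rintegral => y _; exact: shift.
by rewrite /central_diff !addrA; ring.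
Qed.

Lemma primitive_hat r u : 0 < u -> primitive_of (hat r.+1 u) (spline_step r.+1 u).
Proof.
move=> u0; rewrite hatE // -[central_diff u _]/(iter r.+1 (central_diff u) _).
rewrite /spline_step.
have base : primitive_of (@truncated_power R r) (@truncated_power R r.+1).
  by move=> c a b ab; exact: integral_truncated_power.
have iters n : primitive_of (iter n (central_diff u) (@truncated_power R r))
    (iter n (central_diff u) (@truncated_power R r.+1)).
  by elim: n => [|n IH] //=; exact: primitive_central_diff.
exact: iters.
Qed.

End HatFormula.

(** * Periodization *)

Section Periodization.
Local Open Scope classical_set_scope.
Local Open Scope ring_scope.
Context (R : realType).

(** A sum over an infinite type whose support is parametrized by a finite type; it
    serves both for sums over integers and for sums over tuples of integers. *)
Lemma esum_image_fin (T : choiceType) (I : finType) (phi : I -> T) (F : T -> R) :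
  injective phi -> (forall t, 0 <= F t) -> (forall t, F t != 0 -> exists i, t = phi i) ->
  \esum_(t in [set: T]) (F t)%:E = (\sum_i F (phi i))%:E.
Proof.
move=> iphi F0 Fphi.
have -> : \esum_(t in [set: T]) (F t)%:E = \esum_(t in range phi) (F t)%:E.
  rewrite [RHS]esum_mkcond; apply: eq_esum => t _; case: ifPn => // tphi.
  have [->//|/Fphi[i ti]] := eqVneq (F t) 0.
  by move: tphi; rewrite notin_setE => -[]; exists i.
rewrite (reindex_esum [set: I] _ phi); last first.
  by split => // i j _ _; exact: iphi.
rewrite esum_fset; last by move=> i _; rewrite lee_fin.
  2: exact: finite_finset.
have -> : [set: I] = [set` enum I].
  by apply/seteqP; split => i //= _; rewrite mem_enum.
by rewrite -fsbig_seq ?enum_uniq // big_enum /= sumEFin.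
Qed.

(** The same expression as in [periodic_hatd], in one variable. *)
Definition periodization (f : R -> R) (x : R) : R :=
  fine (\esum_(k in [set: int]) (f (k%:~R + x))%:E).

(** Nonnegativity makes the sums over all integers meaningful, and the support
    bound makes them finite. *)
Definition nonneg_supported (A : R) (f : R -> R) : Prop :=
  (forall x, 0 <= f x) /\ (forall x, A <= `|x| -> f x = 0).

Let window (K : nat) (m : 'I_(2 * K)) : int := m%:Z - K%:Z.

Let window_inj K : injective (@window K).
Proof. by move=> i j /addIr [] /val_inj. Qed.

Let windowP (K : nat) (k : int) : - K%:Z <= k < K%:Z -> exists m, k = @window K m.
Proof.
move=> /andP[k1 k2]; have km : (absz (k + K%:Z)%R < 2 * K)%N by lia.
by exists (Ordinal km); rewrite /window /=; lia.
Qed.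

Let window_cover (A : R) f (K : nat) x (k : int) : nonneg_supported A f -> A + `|x| <= K%:R ->
  f (k%:~R + x) != 0 -> - K%:Z <= k < K%:Z.
Proof.
move=> [f0 fA] AK; apply: contra_neqT => kK; apply: fA.
have hx := ler_norm x; have hx' := ler_norm (- x); rewrite normrN in hx'.
have hk := ler_norm (k%:~R + x); have hk' := ler_norm (- (k%:~R + x)).
rewrite normrN in hk'.
have [h|h] := leP K%:Z k.
  have : (K%:Z%:~R <= k%:~R :> R) by rewrite ler_int.
  by rewrite -pmulrn; lra.
have h2 : k + 1 <= - K%:Z by lia.
have : ((k + 1)%:~R <= (- K%:Z)%:~R :> R) by rewrite ler_int.
by rewrite rmorphN /= rmorphD /= -pmulrn; lra.
Qed.

(** Integers outside the window move [x] out of the support. *)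
Lemma periodizationE (A : R) f (K : nat) x : nonneg_supported A f -> A + `|x| <= K%:R ->
  periodization f x = \sum_(m < 2 * K) f (m%:R - K%:R + x).
Proof.
move=> fA AK; rewrite /periodization (@esum_image_fin _ _ (@window K)) /=.
- by apply: eq_bigr => m _; rewrite /window rmorphB /= -!pmulrn.
- exact: window_inj.
- by move=> k; case: fA.
- by move=> k fk; apply: windowP; exact: (window_cover fA AK fk).
Qed.

Lemma exists_window (A x : R) : exists K : nat, A + `|x| <= K%:R.
Proof.
exists (Num.bound `|A + `|x| |); apply: le_trans (ler_norm _) _.
by apply: ltW; exact: archi_boundP.
Qed.

Lemma periodization_ge0 f x : (forall y, 0 <= f y) -> 0 <= periodization f x.
Proof. by move=> f0; apply: fine_ge0; apply: esum_ge0 => k _; rewrite lee_fin. Qed.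

Lemma periodization_period A f x : nonneg_supported A f -> periodization f (x + 1) = periodization f x.
Proof.
move=> fA; rewrite /periodization; congr fine.
rewrite [RHS](reindex_esum [set: int] [set: int] (fun k => k + 1)) /=; last first.
  split => // [i j _ _ /addIr //|k _]; exists (k - 1) => //=; exact: subrK.
by apply: eq_esum => k _; rewrite rmorphD /= [x + 1]addrC addrA.
Qed.

Lemma periodization_sum (A : R) (n : nat) (f : 'I_n -> R -> R) x :
  (forall i, nonneg_supported A (f i)) ->
  periodization (fun y => \sum_i f i y) x = \sum_i periodization (f i) x.
Proof.
move=> fA; have [K hK] := exists_window A x.
have sA : nonneg_supported A (fun y => \sum_i f i y).
  split=> [y|y yA]; first by apply: sumr_ge0 => i _; case: (fA i).
  by rewrite big1 // => i _; case: (fA i) => _ ->.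
rewrite (periodizationE sA hK).
under [RHS]eq_bigr => i _ do rewrite (periodizationE (fA i) hK).
by rewrite exchange_big.
Qed.

Lemma periodization_shift f c x :
  periodization (fun y => f (y + c)) x = periodization f (x + c).
Proof.
by rewrite /periodization; congr fine; apply: eq_esum => k _; rewrite addrA.
Qed.

(** The support lies in a product of windows, over which a sum of products is a
    product of sums. *)
Lemma periodic_hatdE d r (x z u : d.-tuple R) (A : R) :
  (forall j, nonneg_supported A (hat r (tnth u j))) ->
  periodic_hatd r x z u =
  \prod_(j < d) periodization (hat r (tnth u j)) (tnth x j - tnth z j).
Proof.
move=> uA.
have [K hK] : exists K : nat, forall j : 'I_d, A + `|tnth x j - tnth z j| <= K%:R.
  pose B := \big[Num.max/0]_(j < d) `|tnth x j - tnth z j|.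
  have [K hK] := exists_window A B; exists K => j; apply: le_trans hK.
  by rewrite lerD2l (le_trans _ (ler_norm _)) // /B le_bigmax.
pose phi (m : {ffun 'I_d -> 'I_(2 * K)}) : d.-tuple int := [tuple window (m j) | j < d].
rewrite /periodic_hatd (@esum_image_fin _ _ phi) /=.
- transitivity (\sum_(m : {ffun 'I_d -> 'I_(2 * K)}) \prod_j
      hat r (tnth u j) ((m j)%:R - K%:R + (tnth x j - tnth z j))).
    apply: eq_bigr => m _; apply: eq_bigr => j _.
    by rewrite !tnth_mktuple /window rmorphB /= -!pmulrn addrA.
  rewrite -(bigA_distr_bigA (fun j (m : 'I_(2 * K)) =>
    hat r (tnth u j) (m%:R - K%:R + (tnth x j - tnth z j)))).
  by apply: eq_bigr => j _; rewrite (periodizationE (uA j) (hK j)).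
- move=> m m' /(congr1 (fun t => tnth t)) e; apply/ffunP => j.
  by move: (congr1 (fun g => g j) e); rewrite !tnth_mktuple => /window_inj.
- by move=> k; apply: prodr_ge0 => j _; case: (uA j).
- move=> k hk.
  have kj j : exists m, tnth k j = @window K m.
    apply: windowP; apply: (window_cover (uA j) (hK j)).
    move: hk => /prodf_neq0 /(_ j isT) /=.
    by rewrite !tnth_mktuple addrA.
  have [m mk] := choice kj.
  exists [ffun j => m j]; apply: eq_from_tnth => j.
  by rewrite tnth_mktuple ffunE.
Qed.

End Periodization.

(** * Integrals of hat functions *)

Section Integrals.
Local Open Scope classical_set_scope.
Local Open Scope ring_scope.
Context (R : realType).
Local Notation mu := (@lebesgue_measure R).

Lemma hat_nonneg_supported r (u : R) : 0 < u -> u <= 1 -> nonneg_supported r.+1%:R (hat r.+1 u).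
Proof.
move=> u0 u1; split=> [x|x hx]; first exact: hat_ge0.
have r0 : 1 <= r.+1%:R :> R by rewrite ler1n.
have ur : r.+1%:R * u / 2 < r.+1%:R.
  rewrite ltr_pdivrMr // (@le_lt_trans _ _ r.+1%:R) //; last by lra.
  by rewrite ler_piMr.
have [x0|x0] := leP 0 x.
  by rewrite hat_right //; move: hx; rewrite ger0_norm //; lra.
by rewrite hat_left //; move: hx; rewrite ltr0_norm //; lra.
Qed.

Lemma primitive_sum n (f g : nat -> R -> R) :
  (forall i, primitive_of (f i) (g i)) ->
  primitive_of (fun x => \sum_(i < n) f i x) (fun x => \sum_(i < n) g i x).
Proof.
move=> fg; elim: n => [|n IH] c a b ab.
  rewrite (_ : (fun y => \sum_(i < 0) _) = cst 0); last first.
    by apply/funext => y; rewrite big_ord0.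
  rewrite !big_ord0 subrr; split; last by rewrite Rintegral_cst // mul0r.
  exact: integrable0.
have [i1 e1] := IH c a b ab; have [i2 e2] := fg n c a b ab; split.
  rewrite (_ : _ \o _ =
      (fun y => (\sum_(i < n) f i (y + c))%:E + (f n (y + c))%:E)%E).
    by apply: integrableD.
  by apply/funext => y /=; rewrite big_ord_recr.
transitivity (\int[mu]_(y in `[a, b[) (\sum_(i < n) f i (y + c) + f n (y + c))).
  by apply: eq_Rintegral => y _; rewrite big_ord_recr.
by rewrite RintegralD // e1 e2 !big_ord_recr /=; ring.
Qed.

Lemma primitive_shift (f g : R -> R) c :
  primitive_of f g -> primitive_of (fun x => f (c + x)) (fun x => g (c + x)).
Proof.
move=> fg e a b ab; have [i1 e1] := fg (c + e) a b ab.
have s y : c + (y + e) = y + (c + e) by ring.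
split; last by rewrite !s -e1; apply: eq_Rintegral => y _; rewrite s.
by move: i1; congr (mu.-integrable _ _); apply/funext => y /=; rewrite s.
Qed.

(** The primitives telescope over the translates: the integral over one period is
    the total increase of a step of height [u ^ r.+1]. *)
Lemma integral_windowed_hat r (u z : R) (K : nat) : 0 < u -> u <= 1 ->
  (r.+1)%:R + 1 <= K%:R :> R -> 0 <= z < 1 ->
  mu.-integrable `[0, 1[
    (EFin \o (fun x => \sum_(m < 2 * K) hat r.+1 u (m%:R - K%:R + (x - z)))) /\
  \int[mu]_(x in `[0, 1[) (\sum_(m < 2 * K) hat r.+1 u (m%:R - K%:R + (x - z)))
  = u ^+ r.+1.
Proof.
move=> u0 u1 rK /andP[z0 z1].
have pr := primitive_sum (2 * K) (fun m : nat =>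
  primitive_shift (m%:R - K%:R) (primitive_hat r u0)).
have [i1 ->] := pr (- z) 0 1 ler01; split=> //.
pose G (m : nat) := spline_step r.+1 u (m%:R - K%:R - z).
have -> : \sum_(i < 2 * K) spline_step r.+1 u (i%:R - K%:R + (1 - z)) =
    \sum_(i < 2 * K) G i.+1.
  by apply: eq_bigr => i _; rewrite /G -natr1; congr (spline_step _ _ _); ring.
have -> : \sum_(i < 2 * K) spline_step r.+1 u (i%:R - K%:R + (0 - z)) =
    \sum_(i < 2 * K) G i.
  by apply: eq_bigr => i _; rewrite /G sub0r.
rewrite -sumrB -(big_mkord xpredT (fun i => G i.+1 - G i)) telescope_sumr //.
have ur : r.+1%:R * u / 2 <= r.+1%:R.
  rewrite ler_pdivrMr // (@le_trans _ _ r.+1%:R) //; first by rewrite ler_piMr.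
  by rewrite ler_peMr // ler1n.
rewrite /G natrM spline_step_right //; last by lra.
by rewrite spline_step_left ?subr0 //; lra.
Qed.

(** Tonelli, one coordinate at a time, following the recursive definition of
    [tuple_lebesgue]. *)
Lemma integral_tuple_prod n (g : 'I_n -> R -> R) :
  (forall j, measurable_fun [set: R] (g j)) -> (forall j x, 0 <= g j x) ->
  (\int[tuple_lebesgue R n]_t (\prod_j g j (tnth t j))%:E =
   \prod_j \int[mu]_x (g j x)%:E)%E.
Proof.
have mprod k (h : 'I_k -> R -> R) : (forall j, measurable_fun [set: R] (h j)) ->
    measurable_fun [set: k.-tuple (measurableTypeR R)]
      (fun t => (\prod_j h j (tnth t j))%:E).
  move=> mh; apply/measurable_EFinP; apply: measurable_prod => j _.
  by apply: (measurableT_comp (mh j)); exact: measurable_tnth.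
elim: n g => [|n IH] g mg g0.
  rewrite big_ord0 /= integral_dirac //; last exact: mprod.
  by rewrite diracT mul1e big_ord0.
pose tl := tuple_lebesgue R n.
(* Lebesgue measure on (n + 1)-tuples is by definition the image of a product
   measure under this map. *)
pose consp (p : measurableTypeR R * n.-tuple (measurableTypeR R)) :
  n.+1.-tuple (measurableTypeR R) := [tuple of p.1 :: p.2].
have mconsp : measurable_fun [set: measurableTypeR R * n.-tuple (measurableTypeR R)] consp.
  exact: measurable_cons.
transitivity (\int[pushforward (mu \x tl)%E consp]_t (\prod_j g j (tnth t j))%:E)%E.
  by [].
rewrite ge0_integral_pushforward //; last 2 first.
- exact: mprod.
- by move=> t _; rewrite lee_fin prodr_ge0.
rewrite preimage_setT.
have m2 : measurable_fun [set: measurableTypeR R * n.-tuple (measurableTypeR R)]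
    ((fun t => (\prod_j g j (tnth t j))%:E) \o consp).
  by apply: measurableT_comp => //; exact: mprod.
rewrite fubini_tonelli1 //; last by move=> p /=; rewrite lee_fin prodr_ge0.
pose g' (j : 'I_n) := g (lift ord0 j).
have C0 : (0 <= \prod_j \int[mu]_x (g' j x)%:E)%E.
  by apply: prode_ge0 => j _; apply: integral_ge0 => x _; rewrite lee_fin /g'.
rewrite big_ord_recl -/g' -ge0_integralZr //; last 2 first.
- by apply/measurable_EFinP; exact: mg.
- by move=> x _; rewrite lee_fin.
apply: eq_integral => x _; rewrite /fubini_F /= -IH; last 2 first.
- by move=> j; exact: mg.
- by move=> j y; exact: g0.
rewrite -ge0_integralZl //; last first.
- by rewrite lee_fin.
- by move=> t _; rewrite lee_fin prodr_ge0 // => j _; exact: g0.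
- by apply: (mprod n g') => j; exact: mg.
apply: eq_integral => t _; rewrite -EFinM big_ord_recl /consp; congr (_ * _)%:E.
by apply: eq_bigr => j _; rewrite tnthS.
Qed.

End Integrals.

(** * Integrals over the cube, and refinement of hat functions *)

Section CubeIntegral.
Local Open Scope classical_set_scope.
Local Open Scope ring_scope.
Context (R : realType).
Local Notation mu := (@lebesgue_measure R).

(** On the unit cube one finite window serves all points, so the integrand can be
    replaced by a product of finite sums, for which Tonelli applies. *)
Lemma integral_periodic_hatd d r (z u : d.-tuple R) :
  unit_cube z -> (forall j, 0 < tnth u j <= 1) ->
  \int[tuple_lebesgue R d]_(x in @unit_cube R d) periodic_hatd r.+1 x z u =
  \prod_(j < d) tnth u j ^+ r.+1.
Proof.
move=> zc u01.
have bo j : nonneg_supported r.+1%:R (hat r.+1 (tnth u j)).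
  by have /andP[u0 u1] := u01 j; exact: hat_nonneg_supported.
(* The hats vanish beyond distance r + 1, and |x - z| < 1 on the cube. *)
pose K := r.+2.
pose w j x := \sum_(m < 2 * K) hat r.+1 (tnth u j) (m%:R - K%:R + (x - tnth z j)).
pose g j x := (\1_(`[0, 1[%classic : set R) x) * w j x.
have w0 j x : 0 <= w j x by apply: sumr_ge0 => m _; exact: hat_ge0.
have g0 j x : 0 <= g j x by rewrite mulr_ge0 // indicE ler0n.
have mg j : measurable_fun [set: R] (g j).
  have /andP[u0 _] := u01 j.
  apply: measurable_funM; first by apply: measurable_indic; exact: measurable_itv.
  apply: measurable_sum => m; apply: (measurableT_comp (measurable_hat r u0)).
  apply: measurable_funD => //; exact: measurable_funB.
have gE j : (\int[mu]_x (g j x)%:E = (tnth u j ^+ r.+1)%:E)%E.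
  have /andP[u0 u1] := u01 j; have z01 := zc j.
  have rK : r.+1%:R + 1 <= K%:R :> R by rewrite natr1.
  have [i1 e1] := integral_windowed_hat u0 u1 rK z01.
  rewrite -e1 /Rintegral fineK; last exact: (integrable_fin_num _ i1).
  rewrite [RHS]integral_mkcond; apply: eq_integral => x _.
  rewrite patchE /g indicE !mem_setE.
  by case: (x \in _); rewrite ?mul1r ?mul0r.
rewrite /Rintegral integral_mkcond.
transitivity (fine (\int[tuple_lebesgue R d]_t (\prod_j g j (tnth t j))%:E)); last first.
  rewrite integral_tuple_prod //; under eq_bigr => j _ do rewrite gE.
  by rewrite prodEFin.
congr fine; apply: eq_integral => x _; rewrite patchE; case: ifPn => xc.
  have {}xc : unit_cube x by rewrite inE in xc.
  congr EFin; rewrite (periodic_hatdE _ _ bo); apply: eq_bigr => j _.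
  have /andP[x0 x1] := xc j; have /andP[z0 z1] := zc j.
  rewrite (periodizationE (bo j) (K := K)).
    by rewrite /g indicE mem_setE in_itv /= x0 x1 mul1r.
  rewrite /K -[r.+2%:R]natr1 lerD2l ler_norml; lra.
have [j xj] : exists j, ~ (0 <= tnth x j < 1).
  by move: xc; rewrite notin_setE /unit_cube /= -existsNE.
rewrite (bigD1 j) //= /g indicE mem_setE in_itv /=.
by case: (_ && _) xj => //= _; rewrite mul0r mul0r.
Qed.

End CubeIntegral.

Section ShiftSums.
Local Open Scope classical_set_scope.
Local Open Scope ring_scope.
Context (R : realType).
Implicit Types (f : R -> R) (a : nat) (u x : R).

Definition centred_sum a u f x := \sum_(i < a) f (x + (i%:R - (a%:R - 1) / 2) * u).
Definition forward_sum a u f x := \sum_(i < a) f (x + i%:R * u).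
Definition backward_sum a u f x := \sum_(i < a) f (x - i%:R * u).

(** Telescoping: a long central difference is a sum of short ones. *)
Lemma central_diff_mul a u f :
  central_diff (a%:R * u) f = centred_sum a u (central_diff u f).
Proof.
apply/funext => x; pose F (i : nat) := f (x + (i%:R - a%:R / 2) * u).
transitivity (\sum_(i < a) (F i.+1 - F i)).
  rewrite -(big_mkord xpredT (fun i => F i.+1 - F i)) telescope_sumr //.
  by rewrite /F /central_diff; congr (f _ - f _); field.
apply: eq_bigr => i _; rewrite /F /central_diff -natr1.
by congr (f _ - f _); field.
Qed.

Lemma central_diff_centred_sum v a u f :
  central_diff v (centred_sum a u f) = centred_sum a u (central_diff v f).
Proof.
apply/funext => x; rewrite /central_diff /centred_sum -sumrB.
by apply: eq_bigr => i _; congr (f _ - f _); ring.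
Qed.

Lemma iter_central_diff_mul n a u f :
  iter n (central_diff (a%:R * u)) f =
  iter n (centred_sum a u) (iter n (central_diff u) f).
Proof.
elim: n f => // n IH f; rewrite iterSr IH central_diff_mul.
rewrite [in RHS]iterSr -[iter n.+1 (central_diff u) f]/(iter n.+1 (central_diff u) f).
rewrite [in RHS]iterSr; congr (iter n _ _).
by elim: n {IH} => //= n ->; rewrite central_diff_centred_sum.
Qed.

(** Refinement of hats: differences commute with sums of shifts, so each of the
    r + 1 long differences contributes one centred sum. *)
Lemma hat_centred_sum r a u : 0 < u -> (0 < a)%N ->
  hat r.+1 (a%:R * u) = iter r.+1 (centred_sum a u) (hat r.+1 u).
Proof.
move=> u0 a0; rewrite !hatE ?mulr_gt0 ?ltr0n //.
by rewrite -[LHS]/(iter r.+1 (central_diff _) _) iter_central_diff_mul.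
Qed.

(** The centred sums shift by half-integers when [a] is even; two of them together
    shift by integers. It is here that the order of the hat has to be even. *)
Lemma centred_sum_twice a u f :
  centred_sum a u (centred_sum a u f) = forward_sum a u (backward_sum a u f).
Proof.
apply/funext => x; rewrite /centred_sum /forward_sum /backward_sum.
apply: eq_bigr => i _; rewrite (reindex_inj rev_ord_inj) /=; apply: eq_bigr => j _.
by congr f; rewrite natrB; [rewrite -natr1; field|exact: ltn_ord].
Qed.

Lemma iter_centred_sum s a u f :
  iter (2 * s) (centred_sum a u) f =
  iter s (fun g => forward_sum a u (backward_sum a u g)) f.
Proof. by rewrite mul2n; elim: s => //= s <-; rewrite -centred_sum_twice. Qed.

Lemma nonneg_supported_shift A f c : nonneg_supported A f -> nonneg_supported (A + `|c|) (fun x => f (x + c)).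
Proof.
move=> [f0 fA]; split=> // x hx; apply: fA.
have := ler_normD (x + c) (- c); rewrite addrK normrN; lra.
Qed.

Lemma nonneg_supportedW A B f : A <= B -> nonneg_supported A f -> nonneg_supported B f.
Proof. by move=> AB [f0 fA]; split=> // x Bx; apply: fA; exact: le_trans Bx. Qed.

Lemma periodization_shifts A f a (c : nat -> R) :
  nonneg_supported A f ->
  periodization (fun x => \sum_(i < a) f (x + c i)) =
    (fun x => \sum_(i < a) periodization f (x + c i)) /\
  exists A', nonneg_supported A' (fun x => \sum_(i < a) f (x + c i)).
Proof.
move=> fA; pose B := A + \sum_(i < a) `|c i|.
have bB (i : 'I_a) : nonneg_supported B (fun x => f (x + c i)).
  apply: nonneg_supportedW (nonneg_supported_shift (c i) fA).
  by rewrite lerD2l (bigD1 i) //= lerDl sumr_ge0.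
split.
  apply/funext => x; rewrite (periodization_sum _ bB).
  by apply: eq_bigr => i _; rewrite periodization_shift.
exists B; split=> [x|x xB]; first by apply: sumr_ge0 => i _; case: (bB i).
by rewrite big1 // => i _; case: (bB i) => _ ->.
Qed.

Lemma periodization_iter s a u A f : nonneg_supported A f ->
  periodization (iter s (fun g => forward_sum a u (backward_sum a u g)) f) =
  iter s (fun g => forward_sum a u (backward_sum a u g)) (periodization f).
Proof.
move=> fA.
suff [] : periodization (iter s (fun g => forward_sum a u (backward_sum a u g)) f) =
  iter s (fun g => forward_sum a u (backward_sum a u g)) (periodization f) /\
  exists A', nonneg_supported A' (iter s (fun g => forward_sum a u (backward_sum a u g)) f) by [].
elim: s => [|s [IH [A' bA']]]; first by split=> //; exists A.
have [e1 [A1 b1]] := periodization_shifts a (fun i : nat => - (i%:R * u)) bA'.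
have [e2 b2] := periodization_shifts a (fun i : nat => i%:R * u) b1.
by split=> //=; rewrite -IH /forward_sum e2 /backward_sum e1.
Qed.

Lemma periodization_hat_mul s a u : (0 < s)%N -> 0 < u -> u <= 1 -> (0 < a)%N ->
  periodization (hat (2 * s) (a%:R * u)) =
  iter s (fun g => forward_sum a u (backward_sum a u g)) (periodization (hat (2 * s) u)).
Proof.
case: s => // s _ u0 u1 a0.
have e : (2 * s.+1 = (2 * s).+2)%N by lia.
have b := hat_nonneg_supported (2 * s).+1 u0 u1.
rewrite -(periodization_iter _ _ _ (A := (2 * s).+2%:R)); last by rewrite e.
by rewrite -iter_centred_sum e hat_centred_sum.
Qed.

End ShiftSums.

(** * Sampling periodized hats on a grid *)

Section GridSampling.
Local Open Scope classical_set_scope.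
Local Open Scope ring_scope.
Context (R : realType) (p : nat).
Local Notation N := p.+2.
Local Notation circulant := (horner_mx (cyclic_shift R p)).
Implicit Types (g : R -> R) (x xi : R) (a s : nat).

Definition one_periodic g := forall x, g (x + 1) = g x.

Definition sample xi g : 'cV[R]_N := \col_(t < N) g (xi - t%:R / N%:R).

Lemma periodic_forward a u g : one_periodic g -> one_periodic (forward_sum a u g).
Proof. by move=> gp x; apply: eq_bigr => i _; rewrite addrAC gp. Qed.

Lemma periodic_backward a u g : one_periodic g -> one_periodic (backward_sum a u g).
Proof. by move=> gp x; apply: eq_bigr => i _; rewrite addrAC gp. Qed.

Lemma periodic_natmul g x n : one_periodic g -> g (x - n%:R) = g x.
Proof.
move=> gp; elim: n => [|n IH]; first by rewrite subr0.
by rewrite -natr1 -[LHS]gp opprD addrA subrK.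
Qed.

(** Samples only depend on the residue of the index. *)
Lemma periodic_modn g x n : one_periodic g ->
  g (x - (n %% N)%N%:R / N%:R) = g (x - n%:R / N%:R).
Proof.
move=> gp; rewrite [in RHS](divn_eq n N) natrD natrM mulrDl mulfK ?pnatr_eq0 //.
by rewrite [_%:R + _]addrC opprD addrA (periodic_natmul _ _ gp).
Qed.

Let circulant_geometric a (i j : 'I_N) :
  circulant (\sum_(k < a) 'X^k) i j = \sum_(k < a) (i == j + k%:R)%:R.
Proof.
by rewrite rmorph_sum summxE; apply: eq_bigr => k _; rewrite circulantXn.
Qed.

Let val_natr (k : nat) : ((k%:R : 'I_N) : nat) = (k %% N)%N.
Proof. by rewrite Zp_nat. Qed.

(** On samples, shifting a periodic function by 1 / N is multiplication by X. *)
Lemma sample_forward a xi g : one_periodic g ->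
  sample xi (forward_sum a N%:R^-1 g) =
  circulant (\sum_(k < a) 'X^k) *m sample xi g.
Proof.
move=> gp; apply/matrixP => t j; rewrite !mxE /forward_sum.
under [RHS]eq_bigr => y _ do rewrite circulant_geometric mulr_suml.
rewrite exchange_big; apply: eq_bigr => i _ /=.
rewrite (bigD1 (t - i%:R)) //= subrK eqxx mul1r mxE big1 ?addr0; last first.
  by move=> y yt; rewrite -subr_eq eq_sym (negPf yt) mul0r.
set y := (t - i%:R : 'I_N).
have -> : (t : nat) = ((y + i) %% N)%N.
  rewrite -[t in LHS](subrK (i%:R : 'I_N)) -/y /= val_natr.
  by rewrite modnDmr.
rewrite addrAC (periodic_modn _ _ gp); congr g.
have : N%:R != 0 :> R by rewrite pnatr_eq0.
by rewrite natrD; move: (N%:R) => n n0; field.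
Qed.

Lemma sample_backward a xi g : one_periodic g ->
  sample xi (backward_sum a N%:R^-1 g) =
  (circulant (\sum_(k < a) 'X^k))^T *m sample xi g.
Proof.
move=> gp; apply/matrixP => t j; rewrite !mxE /backward_sum.
under [RHS]eq_bigr => y _ do rewrite mxE circulant_geometric mulr_suml.
rewrite exchange_big; apply: eq_bigr => i _ /=.
rewrite (bigD1 (t + i%:R)) //= eqxx mul1r mxE big1 ?addr0; last first.
  by move=> y /negPf yt; rewrite yt mul0r.
set y : 'I_N := t + i%:R.
have -> : (y : nat) = ((t + i) %% N)%N by rewrite /= val_natr modnDmr.
by rewrite (periodic_modn _ _ gp) natrD mulrDl opprD addrA.
Qed.

(** All factors are polynomials in the shift, hence commute. *)
Lemma box_kernelS s a : box_kernel R p s.+1 a =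
  circulant (\sum_(k < a) 'X^k) *m (circulant (\sum_(k < a) 'X^k))^T *m box_kernel R p s a.
Proof.
have cM f1 f2 : circulant f1 *m circulant f2 = circulant (f1 * f2) by rewrite rmorphM.
rewrite /box_kernel !trmx_circulant !cM; congr (horner_mx _ _).
by rewrite /spline_power exprS rmorphM /=; ring.
Qed.

Lemma sample_iter s a xi g : one_periodic g ->
  sample xi (iter s (fun g => forward_sum a N%:R^-1 (backward_sum a N%:R^-1 g)) g) =
  box_kernel R p s a *m sample xi g.
Proof.
move=> gp.
suff [] : sample xi (iter s (fun g => forward_sum a N%:R^-1 (backward_sum a N%:R^-1 g)) g) =
    box_kernel R p s a *m sample xi g /\
  one_periodic (iter s (fun g => forward_sum a N%:R^-1 (backward_sum a N%:R^-1 g)) g) by [].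
elim: s => [|s [IH1 IH2]].
  split=> //=; rewrite /box_kernel /spline_power expr0 rmorph1 trmx1.
  by rewrite -[1]/(1%:M) !mul1mx.
split=> /=; last by apply: periodic_forward; exact: periodic_backward.
rewrite sample_forward; last exact: periodic_backward.
by rewrite sample_backward // IH1 box_kernelS !mulmxA.
Qed.

Variable s : nat.
Hypothesis s0 : (0 < s)%N.

Definition grid_hat := periodization (hat (2 * s) (N%:R^-1 : R)).
(** The weight that a node at [xi] puts on the grid point [t]. *)
Definition grid_coef xi (t : 'I_N) : R := grid_hat (xi - t%:R / N%:R).

Let u0 : 0 < (N%:R^-1 : R). Proof. by rewrite invr_gt0 ltr0n. Qed.
Let u1 : (N%:R^-1 : R) <= 1. Proof. by rewrite invf_le1 ?ltr0n // ler1n. Qed.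
Let r := (2 * s).-1.
Let rE : (2 * s = r.+1)%N. Proof. by rewrite /r; lia. Qed.
Let bo : nonneg_supported r.+1%:R (hat (2 * s) (N%:R^-1 : R)).
Proof. by rewrite rE; exact: hat_nonneg_supported. Qed.

(** The refinement relation, evaluated on the grid. *)
Lemma periodization_hat_grid a (xi : R) (z : 'I_N) : (0 < a)%N ->
  periodization (hat (2 * s) (a%:R / N%:R)) (xi - z%:R / N%:R) =
  \sum_t box_kernel R p s a z t * grid_coef xi t.
Proof.
move=> a0; rewrite periodization_hat_mul //.
have gp : one_periodic grid_hat by move=> x; exact: periodization_period bo.
have /matrixP/(_ z 0) := sample_iter s a xi gp; rewrite !mxE => ->.
by apply: eq_bigr => t _; congr (_ * _); rewrite mxE.
Qed.

Lemma grid_coef_ge0 xi t : 0 <= grid_coef xi t.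
Proof. by apply: periodization_ge0 => y; case: bo. Qed.

(** A partition of unity: the translates of the hat by 1 / N telescope to a
    difference of step 1, whose periodization telescopes to the height of the
    step. *)
Lemma sum_grid_coef xi : \sum_t grid_coef xi t = N%:R ^- (2 * s).-1.
Proof.
have [e _] := periodization_shifts N (fun i : nat => - (i%:R * N%:R^-1)) bo.
rewrite -[LHS]/((fun x => \sum_(i < N) grid_hat (x - i%:R * N%:R^-1)) xi) -e.
have tele x : \sum_(i < N) hat (2 * s) N%:R^-1 (x - i%:R * N%:R^-1) =
    spline_step r N%:R^-1 (x + N%:R^-1 / 2) - spline_step r N%:R^-1 (x + N%:R^-1 / 2 - 1).
  pose F (i : nat) : R := spline_step r N%:R^-1 (x + N%:R^-1 / 2 - i%:R * N%:R^-1).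
  transitivity (- \sum_(i < N) (F i.+1 - F i)).
    rewrite -sumrN; apply: eq_bigr => i _; rewrite rE hatE // /central_diff /F -natr1.
    by rewrite opprB; congr (spline_step _ _ _ - spline_step _ _ _); field.
  rewrite -(big_mkord xpredT (fun i => F i.+1 - F i)) telescope_sumr // opprB /F.
  by rewrite mul0r subr0 divff // pnatr_eq0.
have [A' bA'] := (periodization_shifts N (fun i : nat => - (i%:R * N%:R^-1)) bo).2.
have [K1 hK1] := exists_window A' xi.
have [K2 hK2] := exists_window (r.+1%:R + 2) xi.
pose K := maxn K1 K2.
have hK : A' + `|xi| <= K%:R by apply: le_trans hK1 _; rewrite ler_nat leq_maxl.
have hK' : r.+1%:R + 2 + `|xi| <= K%:R by apply: le_trans hK2 _; rewrite ler_nat leq_maxr.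
rewrite (periodizationE bA' hK).
under eq_bigr => m _ do rewrite tele.
pose F (m : nat) : R := spline_step r N%:R^-1 (m%:R - K%:R + xi + N%:R^-1 / 2 - 1).
rewrite (eq_bigr (fun m : 'I_(2 * K) => F m.+1 - F m)); last first.
  by move=> m _; rewrite /F -natr1; congr (spline_step _ _ _ - _); ring.
rewrite -(big_mkord xpredT (fun i => F i.+1 - F i)) telescope_sumr // /F.
have hx := ler_norm xi; have hx' := ler_norm (- xi); rewrite normrN in hx'.
have ru : r%:R * N%:R^-1 / 2 <= r.+1%:R :> R.
  rewrite ler_pdivrMr // (@le_trans _ _ r%:R) ?ler_piMr // -natr1.
  have : 0 <= r%:R :> R by []. 
  by lra.
have u0' := u0; have u1' := u1.
rewrite natrM spline_step_right //; last first.
  by move: (N%:R^-1) u0' u1' ru => v v0 v1 rv; lra.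
rewrite spline_step_left //; last first.
  by move: (N%:R^-1) u0' u1' ru => v v0 v1 rv; lra.
by rewrite subr0 exprVn.
Qed.

(** If M is the integer part of N xi, the grid points in the support of the hat
    around [xi] are M - s + 1, ..., M + s, taken mod N. *)
Lemma grid_coef_support xi : exists T : {set 'I_N}, (#|T| <= 2 * s)%N /\
  forall t, t \notin T -> grid_coef xi t = 0.
Proof.
pose M : int := Num.floor (N%:R * xi).
pose node (i : 'I_(2 * s)) : 'I_N := (M - s%:Z + 1 + i%:Z)%:~R.
exists [set node i | i : 'I_(2 * s)]; split.
  by apply: leq_trans (leq_imset_card _ _) _; rewrite card_ord.
move=> t; apply: contraNeq; rewrite /grid_coef /grid_hat.
have [K hK] := exists_window r.+1%:R (xi - t%:R / N%:R).
rewrite (periodizationE bo hK) => hs.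
have [m hm] : exists m : 'I_(2 * K), hat (2 * s) N%:R^-1 (m%:R - K%:R + (xi - t%:R / N%:R)) != 0.
  apply/existsP; apply: contraNT hs; rewrite negb_exists => /forallP h.
  by rewrite big1 // => m _; apply/eqP; have := h m; rewrite negbK.
pose k : int := m%:Z - K%:Z.
set y := m%:R - K%:R + (xi - t%:R / N%:R) in hm.
have N0 : 0 < N%:R :> R by rewrite ltr0n.
have yE : N%:R * y = (k * N%:Z - t%:Z)%:~R + N%:R * xi.
  rewrite /y /k !rmorphB rmorphM rmorphB /= -!pmulrn.
  move: (N%:R : R) N0 => n n0; have {n0} : n != 0 by apply: lt0r_neq0.
  by move=> n0; field.
have hy : - s%:R <= N%:R * y < s%:R.
  have e2 : r.+1%:R * N%:R^-1 / 2 = s%:R * N%:R^-1 :> R by rewrite -rE natrM; field.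
  apply/andP; split.
    rewrite leNgt; apply: contraNN hm => h; apply/eqP; rewrite rE.
    by apply: hat_left => //; rewrite e2 -mulNr ltr_pdivlMr // mulrC.
  rewrite ltNge; apply: contraNN hm => h; apply/eqP; rewrite rE.
  by apply: hat_right => //; rewrite e2 ler_pdivrMr // mulrC.
(* The representative of [t] mod N that is close to N xi. *)
pose j : int := t%:Z - k * N%:Z.
have jE : N%:R * xi = N%:R * y + j%:~R by rewrite yE /j -addrA addrC; rewrite !rmorphB; ring.
have /andP[f1 f2] := floor_itv (N%:R * xi); rewrite -/M in f1 f2.
have j1 : j - s%:Z <= M.
  by rewrite /M floor_ge_int rmorphB /= -pmulrn; move: hy => /andP[]; lra.
have j2 : M - s%:Z < j.
  rewrite -(ltr_int R) rmorphB /= -pmulrn; move: hy => /andP[]; lra.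
have hi : (absz (j - (M - s%:Z + 1))%R < 2 * s)%N by lia.
apply/imsetP; exists (Ordinal hi) => //; rewrite /node /=.
have -> : M - s%:Z + 1 + (absz (j - (M - s%:Z + 1))%R)%:Z = j by lia.
rewrite /j rmorphB rmorphM /= -!pmulrn natr_N0 mulr0 subr0.
by rewrite natr_Zp.
Qed.

End GridSampling.

(** * From cubature formulas to measures on the grid *)

Section Discretization.
Local Open Scope classical_set_scope.
Local Open Scope ring_scope.
Context (R : realType) (p s d' m : nat).
Local Notation N := p.+2.
Local Notation d := d'.+1.
Local Notation G := {ffun 'I_d -> 'I_N}.
Hypothesis s0 : (0 < s)%N.
Variables (lambda : 'I_m -> R) (xi : 'I_m -> d.-tuple R).

(** The cubature formula, with each node replaced by its weights on the grid. *)
Definition grid_weight (x : G) : R :=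
  \sum_i lambda i * \prod_j grid_coef s (tnth (xi i) j) (x j).
(** The uniform part has the density for which the hat of width a / N has total
    mass (a / N) ^ (2 s) in each direction. *)
Definition grid_measure (x : G) : R := (N%:R ^- (2 * s)) ^+ d - grid_weight x.

Lemma grid_weight_support : exists S : {set G}, (#|S| <= m * (2 * s) ^ d)%N /\
  forall x, x \notin S -> grid_weight x = 0.
Proof.
have [T TP] := choice (fun y : R => grid_coef_support p s0 y).
pose Sb (i : 'I_m) : {set G} := [set x in family (fun j => T (tnth (xi i) j))]%SET.
exists (\bigcup_i Sb i)%SET; split.
  apply: (@leq_trans (\sum_(i < m) (2 * s) ^ d)); last first.
    by rewrite sum_nat_const card_ord.
  apply: (@leq_trans (\sum_(i < m) #|Sb i|)).
    elim/big_ind2: _ => [|X x Y y hX hY|//]; first by rewrite cards0.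
    by apply: leq_trans (leq_add hX hY); rewrite cardsU leq_subr.
  apply: leq_sum => i _; rewrite cardsE card_family.
  have -> : ((2 * s) ^ d = \prod_(j < d) (2 * s))%N by rewrite prod_nat_const card_ord.
  rewrite -big_enum /image_mem /=; elim: (enum _) => [|j js IH] /=; first by rewrite big_nil.
  by rewrite big_cons leq_mul // (TP _).1.
move=> x xS; rewrite /grid_weight big1 // => i _.
have : x \notin Sb i by apply: contra xS => xS; apply/bigcupP; exists i.
rewrite inE => /familyP xT.
have [j xj] : exists j, x j \notin T (tnth (xi i) j).
  apply/existsP; rewrite -negb_forall; apply/negP => /forallP h'; exact: xT.
by rewrite (bigD1 j) //= (TP _).2 // mul0r mulr0.
Qed.

(** Partition of unity gives each node the same mass as N ^ d points of the
    uniform part. *)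
Lemma sum_norm_grid_measure (B : R) : \sum_(i < m) `|lambda i| <= B ->
  \sum_x `|grid_measure x| <= (1 + B) * (N%:R ^+ d * (N%:R ^+ d) ^- (2 * s)).
Proof.
move=> lambdaB; have N0 : 0 < N%:R :> R by rewrite ltr0n.
apply: (@le_trans _ _ (\sum_(x : G) ((N%:R ^- (2 * s)) ^+ d +
    \sum_i `|lambda i| * \prod_j grid_coef s (tnth (xi i) j) (x j)))).
  apply: ler_sum => x _; rewrite (le_trans (ler_normB _ _)) // lerD //.
    by rewrite ger0_norm // exprn_ge0 // invr_ge0 exprn_ge0.
  rewrite (le_trans (ler_norm_sum _ _ _)) //; apply: ler_sum => i _.
  rewrite normrM ler_wpM2l // ger0_norm // prodr_ge0 // => j _; exact: grid_coef_ge0.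
rewrite big_split /= exchange_big /= sumr_const card_ffun !card_ord.
have -> : \sum_(i < m) \sum_(x : G) `|lambda i| * \prod_j grid_coef s (tnth (xi i) j) (x j) =
    (N%:R ^- (2 * s).-1) ^+ d * \sum_i `|lambda i|.
  rewrite mulr_sumr; apply: eq_bigr => i _; rewrite -mulr_sumr mulrC; congr (_ * _).
  rewrite -(bigA_distr_bigA (fun j t => grid_coef s (tnth (xi i) j) t)).
  rewrite (eq_bigr (fun=> N%:R ^- (2 * s).-1)); last by move=> j _; exact: sum_grid_coef.
  by rewrite prodr_const card_ord.
have e1 : (N%:R ^- (2 * s)) ^+ d *+ N ^ d = N%:R ^+ d * (N%:R ^+ d) ^- (2 * s) :> R.
  by rewrite -mulr_natl natrX exprVn -!exprM mulnC.
have e2 : (N%:R ^- (2 * s).-1) ^+ d = N%:R ^+ d * (N%:R ^+ d) ^- (2 * s) :> R.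
  have [k ->] : exists k, (2 * s = k.+1)%N by exists (2 * s).-1; lia.
  rewrite [(N%:R ^+ d) ^+ k.+1]exprS invfM mulrA divff ?mul1r ?expf_neq0 ?pnatr_eq0 //.
  by rewrite exprVn -!exprM mulnC.
by rewrite e1 e2 mulrDl mul1r lerD2l mulrC ler_wpM2r //.
Qed.

Variable h : nat.
Hypothesis Nh : p.+2 = (2 * h).+1.

(** Integral and cubature sum are both sums against the rows of [box_kernel]: the
    integral because the rows have sum a ^ (2 s), the cubature sum by the
    refinement relation. *)
Lemma cubature_error_grid (z : G) (a : {ffun 'I_d -> 'I_h}) :
  cubature_error (2 * s) lambda xi [tuple (z j)%:R / N%:R | j < d]
     [tuple (a j).+1%:R / N%:R | j < d] =
  `|\sum_(x : G) grid_measure x * \prod_j box_kernel R p s (a j).+1 (z j) (x j)|.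
Proof.
have N0 : 0 < N%:R :> R by rewrite ltr0n.
set zt := mktuple _; set ut := mktuple _.
have ztc : unit_cube zt.
  move=> j; rewrite tnth_mktuple divr_ge0 //= ltr_pdivrMr // mul1r ltr_nat.
  exact: ltn_ord.
have ut01 j : 0 < tnth ut j <= 1.
  rewrite tnth_mktuple divr_gt0 //= ler_pdivrMr // mul1r ler_nat.
  by rewrite Nh; have := ltn_ord (a j); lia.
have rE : (2 * s = (2 * s).-1.+1)%N by lia.
rewrite /cubature_error; congr (`|_|).
have bo j : nonneg_supported (2 * s)%:R (hat (2 * s) (tnth ut j)).
  by have /andP[u0 u1] := ut01 j; rewrite rE; exact: hat_nonneg_supported.
rewrite rE integral_periodic_hatd // -rE /cubature.
have -> : \prod_(j < d) tnth ut j ^+ (2 * s) =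
    \sum_(x : G) (N%:R ^- (2 * s)) ^+ d * \prod_j box_kernel R p s (a j).+1 (z j) (x j).
  rewrite -mulr_sumr -(bigA_distr_bigA (fun j t => box_kernel R p s (a j).+1 (z j) t)).
  under [X in _ = _ * X]eq_bigr => j _ do rewrite sum_box_kernel.
  have -> : (N%:R ^- (2 * s)) ^+ d = \prod_(j < d) N%:R ^- (2 * s) :> R.
    by rewrite prodr_const card_ord.
  rewrite -big_split /=; apply: eq_bigr => j _.
  by rewrite tnth_mktuple expr_div_n mulrC.
have -> : \sum_(i < m) lambda i * periodic_hatd (2 * s) (xi i) zt ut =
    \sum_(x : G) grid_weight x * \prod_j box_kernel R p s (a j).+1 (z j) (x j).
  under [RHS]eq_bigr => x _ do rewrite mulr_suml.
  rewrite exchange_big; apply: eq_bigr => i _ /=.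
  under eq_bigr => x _ do rewrite -mulrA.
  rewrite -mulr_sumr; congr (_ * _).
  rewrite (periodic_hatdE _ _ bo).
  under [RHS]eq_bigr => x _ do rewrite -big_split /=.
  rewrite -(bigA_distr_bigA (fun j t => grid_coef s (tnth (xi i) j) t *
     box_kernel R p s (a j).+1 (z j) t)).
  apply: eq_bigr => j _; rewrite !tnth_mktuple periodization_hat_grid //.
  by apply: eq_bigr => t _; rewrite mulrC.
by rewrite -sumrB; apply: eq_bigr => x _; rewrite -mulrBl.
Qed.

End Discretization.

(** * The lower bound *)

(** The powers of the grid size cancel: Y stands for N ^ d = q ^ d Q X with Q = q ^ t
    and X = q ^ (t d'). *)
Lemma energy_to_error (R : realFieldType) (s : nat) (T Q X qd tc B1 eps : R) :
  0 < T -> 0 < Q -> 0 < X -> 0 < qd -> 0 < tc -> 0 < B1 ->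
  let Y := qd * Q * X in
  (Y ^- (2 * s) * (T * (Q / 2) * X ^+ s.+1)) ^+ 2 <=
    tc * T * (Y * eps * (B1 * (Y * Y ^- (2 * s)))) ->
  (4 * tc * B1 * qd ^+ (2 * s).+2)^-1 * T * Q ^- (2 * s) <= eps.
Proof.
move=> T0 Q0 X0 qd0 tc0 B10 Y.
have Y0 : 0 < Y by rewrite !mulr_gt0.
have Yr0 : 0 < Y ^+ (2 * s) by rewrite exprn_gt0.
have e1 : (Y ^- (2 * s) * (T * (Q / 2) * X ^+ s.+1)) ^+ 2 =
    (T * Q ^+ 2 * X ^+ (2 * s).+2) * (T / (4 * (Y ^+ (2 * s)) ^+ 2)).
  have -> : ((2 * s).+2 = s.+1 + s.+1)%N by lia.
  by rewrite exprD; move: (Y ^+ _) Yr0 (X ^+ _) => y y0 x; field; exact: lt0r_neq0.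
have e2 : tc * T * (Y * eps * (B1 * (Y * Y ^- (2 * s)))) =
    (4 * tc * B1 * eps * (Y ^+ 2 * Y ^+ (2 * s))) * (T / (4 * (Y ^+ (2 * s)) ^+ 2)).
  by move: (Y ^+ (2 * s)) Yr0 => y y0; field; exact: lt0r_neq0.
rewrite e1 e2 ler_pM2r; last by rewrite divr_gt0 // mulr_gt0 // exprn_gt0.
rewrite -exprD add2n.
have -> : Y ^+ (2 * s).+2 = qd ^+ (2 * s).+2 * (Q ^+ (2 * s) * Q ^+ 2) * X ^+ (2 * s).+2.
  by rewrite /Y !exprMn -(exprD Q) addn2.
have a0 : 0 < X ^+ (2 * s).+2 by rewrite exprn_gt0.
have b0 : 0 < qd ^+ (2 * s).+2 by rewrite exprn_gt0.
have c0 : 0 < Q ^+ (2 * s) by rewrite exprn_gt0.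
have f0 : 0 < Q ^+ 2 by rewrite exprn_gt0.
move: (X ^+ _) (qd ^+ _) (Q ^+ (2 * s)) (Q ^+ 2) a0 b0 c0 f0 => a b c f a0 b0 c0 f0.
rewrite !mulrA ler_pM2r // ler_pM2r // => le.
rewrite ler_pdivrMr // -mulrA ler_pdivrMl; last by rewrite !mulr_gt0.
by apply: le_trans le _; rewrite le_eqVlt; apply/orP; left; apply/eqP; ring.
Qed.

Section Cubature.
Variables (R : realType) (d' s : nat) (B : R).
Hypotheses (d0 : (0 < d')%N) (s0 : (0 < s)%N) (B0 : 0 < B).
Local Notation d := d'.+1.

Let q := ((2 * s)`!).+1.

Let q_odd : odd q.
Proof.
rewrite /q /= -dvdn2 dvdn_fact //; lia.
Qed.

Let q_gt1 : (1 < q)%N.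
Proof. by rewrite /q ltnS fact_gt0. Qed.

Let sq : (s < q)%N.
Proof. by rewrite /q ltnS; apply: leq_trans (fact_geq _); lia. Qed.

(** A common factor would divide both (2 s)! and (2 s)! + 1. *)
Let coprime_q n k : (0 < k <= s)%N -> coprime (q ^ n) k.
Proof.
move=> /andP[k0 ks]; apply: coprimeXl; rewrite coprime_sym.
have kq : (k %| (2 * s)`!)%N by rewrite dvdn_fact // k0; lia.
apply: coprime_dvdl kq _.
exact: coprimenS.
Qed.

Definition error_const : R :=
  (4 * test_const R s d' * (1 + B) * (q%:R ^+ d) ^+ (2 * s).+2)^-1.

Lemma error_const_gt0 : 0 < error_const.
Proof.
have B10 : 0 < 1 + B by rewrite addr_gt0.
have tc0 := test_const_gt0 R s d'.
rewrite invr_gt0; apply: mulr_gt0; first by apply: mulr_gt0 => //; exact: mulr_gt0.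
by rewrite !exprn_gt0 // ltr0n.
Qed.

(** The bound for a given resolution: q ^ t has to exceed twice the number of grid
    points that carry the weights, t = d' t0. *)
Lemma cubature_error_lower (m t0 : nat) (lambda : 'I_m -> R) (xi : 'I_m -> d.-tuple R) (eps : R) :
  (0 < t0)%N -> (2 * (m * (2 * s) ^ d) <= q ^ (d' * t0))%N ->
  \sum_(i < m) `|lambda i| <= B ->
  (forall z u, unit_cube z -> width_range u -> cubature_error (2 * s) lambda xi z u <= eps) ->
  error_const * t0%:R ^+ d' * (q ^ (d' * t0))%:R ^- (2 * s) <= eps.
Proof.
move=> t00 mq lB hE; pose t := (d' * t0)%N.
have t1 : (0 < t)%N by rewrite muln_gt0 d0.
have [p Nq] : exists p, p.+2 = (q ^ t.+1)%N.
  exists (q ^ t.+1 - 2)%N.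
  have : (q ^ 1 <= q ^ t.+1)%N by rewrite leq_pexp2l // ltnW.
  rewrite expn1; move: q_gt1; lia.
have Nodd : odd p.+2 by rewrite Nq oddX q_odd orbT.
have [h Nh] : exists h, p.+2 = (2 * h).+1.
  by exists (p.+2)./2; rewrite -[LHS]odd_double_half Nodd mul2n.
have [S [Scard SP]] := grid_weight_support p s0 lambda xi.
have Ssmall : (2 * #|S| <= q ^ t)%N by apply: leq_trans mq; rewrite leq_mul2l Scard.
have cops k : (0 < k <= s)%N -> coprime p.+2 k by rewrite Nq; exact: coprime_q.
have N0 : 0 < (p.+2)%:R :> R by rewrite ltr0n.
have theta0 : 0 <= ((p.+2)%:R ^- (2 * s)) ^+ d :> R.
  by rewrite exprn_ge0 // invr_ge0 exprn_ge0.
have nuS x : x \notin S -> grid_measure s lambda xi x = ((p.+2)%:R ^- (2 * s)) ^+ d.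
  by move=> xS; rewrite /grid_measure SP // subr0.
have nu_eps (z : {ffun 'I_d -> 'I_p.+2}) (a : {ffun 'I_d -> 'I_h}) :
  `|\sum_x grid_measure s lambda xi x * \prod_j box_kernel R p s (a j).+1 (z j) (x j)| <= eps.
  rewrite -(cubature_error_grid s0 _ _ Nh); apply: hE => j.
    rewrite tnth_mktuple divr_ge0 //= ltr_pdivrMr // mul1r ltr_nat.
    exact: ltn_ord.
  rewrite tnth_mktuple divr_gt0 //= ler_pdivrMr // mulrC ler_pdivlMr //.
  rewrite -natrM ler_nat Nh; have := ltn_ord (a j); lia.
have := cyclic_lower_bound s0 sq Nq Nh cops d0 t00 (erefl t) Ssmall theta0 nuS nu_eps.
have h0 : (0 < h)%N by move: Nh; lia.
have eps0 : 0 <= eps.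
  by apply: le_trans (nu_eps [ffun=> ord0] [ffun=> Ordinal h0]).
have B10 : 0 < 1 + B by rewrite addr_gt0.
pose Q : R := (q ^ t)%:R; pose X : R := (q ^ (t * d'))%:R.
have YE : (p.+2)%:R ^+ d = q%:R ^+ d * Q * X :> R.
  rewrite Nq /Q /X -!natrX -!natrM; congr (_%:R).
  by rewrite -expnM mulSn expnD mulnC -mulnA -!expnD; congr (q ^ _)%N; lia.
have Y0 : 0 < (p.+2)%:R ^+ d :> R by rewrite exprn_gt0.
have tc0 := test_const_gt0 R s d'.
move=> main; apply: (@energy_to_error R s (t0%:R ^+ d') Q X _ _ _ _).
- by rewrite exprn_gt0 // ltr0n.
- by rewrite ltr0n expn_gt0.
- by rewrite ltr0n expn_gt0.
- by rewrite exprn_gt0 // ltr0n.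
- exact: tc0.
- exact: B10.
rewrite -YE.
have -> : ((p.+2)%:R ^+ d) ^- (2 * s) = ((p.+2)%:R ^- (2 * s)) ^+ d :> R.
  by rewrite exprVn -!exprM mulnC.
apply: le_trans main _.
rewrite ler_wpM2l //; first by rewrite mulr_ge0 ?(ltW tc0) // exprn_ge0.
apply: ler_pM => //.
- by rewrite mulr_ge0 // exprn_ge0.
- exact: sumr_ge0.
- rewrite ler_wpM2r // lerXn2r ?nnegrE // ler_nat Nh; lia.
rewrite (le_trans (sum_norm_grid_measure p s0 xi lB)) //.
by rewrite exprVn -!exprM [(d * _)%N]mulnC.
Qed.

End Cubature.

Theorem theorem3p1 (R : realType) (d r : nat) (B : R)
    (hd : (2 <= d)%N) (hr0 : (0 < r)%N) (hr : ~~ odd r) (hB : 0 < B) :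
  exists2 C : R, 0 < C &
    forall m : nat, (0 < m)%N ->
      ((C * m%:R ^- r * ln m%:R ^+ d.-1)%:E <= hat_discrepancy d r B m)%E.
Proof.
case: d hd => // d' hd; have {hd} d0 : (0 < d')%N by [].
have [s rE] : exists s, r = (2 * s)%N.
  by exists r./2; rewrite -[LHS]odd_double_half (negPf hr) mul2n.
have s0 : (0 < s)%N by move: hr0; rewrite rE; lia.
rewrite {r hr0 hr}rE /=.
pose q := ((2 * s)`!).+1; pose q' := (q ^ d')%N.
have q'1 : (1 < q')%N by rewrite -(exp1n d') ltn_exp2r // /q ltnS fact_gt0.
have lnq' : 0 < ln q'%:R :> R by rewrite ln_gt0 // ltr1n.
pose K := (2 * (2 * s) ^ d'.+1)%N.
have K0 : (0 < K)%N by rewrite muln_gt0 expn_gt0; lia.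
exists (error_const d' s B * (ln q'%:R ^+ d')^-1 * (q' * K)%:R ^- (2 * s)).
  rewrite !mulr_gt0 ?error_const_gt0 // invr_gt0 exprn_gt0 //.
  by rewrite ltr0n muln_gt0 K0 ltnW.
move=> m m0; apply: le_ereal_inf_tmp => _ [[lambda xi] [/= lB xic] <-].
set E := (X in ereal_sup X).
have supE z u : unit_cube z -> width_range u ->
    ((cubature_error (2 * s) lambda xi z u)%:E <= ereal_sup E)%E.
  by move=> zc uw; apply: ereal_sup_ubound; exists (z, u).
have : (0%:E <= ereal_sup E)%E.
  pose z0 : d'.+1.-tuple R := [tuple 0 | j < d'.+1].
  pose u0 : d'.+1.-tuple R := [tuple 2^-1 | j < d'.+1].
  apply: (@le_trans _ _ (cubature_error (2 * s) lambda xi z0 u0)%:E).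
    by rewrite lee_fin /cubature_error.
  by apply: supE => j; rewrite tnth_mktuple ?lexx ?ltr01 // invr_gt0 ltr0n /=.
case: (ereal_sup E) supE => [eps supE _|_ _|//]; last exact: leey.
rewrite lee_fin.
(* The coarsest resolution at which half of the boxes of each shape miss the
   nodes; minimality of [t0] bounds q ^ (d' t0) by a multiple of [m]. *)
pose M := (m * K)%N; pose t0 := up_log q' M.
have M1 : (1 < M)%N.
  rewrite /M /K mulnCA; apply: (@leq_trans (2 * 1)) => //.
  by rewrite leq_mul2l muln_gt0 m0 expn_gt0; lia.
have t00 : (0 < t0)%N by rewrite up_log_gt0 q'1.
have Mle : (M <= q ^ (d' * t0))%N by rewrite expnM; exact: up_logP.
have leM : (q ^ (d' * t0) <= q' * M)%N.
  rewrite expnM -/q' -(prednK t00) expnS leq_mul2l; apply/orP; right.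
  by apply: ltnW; exact: up_log_gtn.
have main : error_const d' s B * t0%:R ^+ d' * (q ^ (d' * t0))%:R ^- (2 * s) <= eps.
  apply: (@cubature_error_lower R d' s B d0 s0 hB m t0 lambda xi) => //.
  by apply: leq_trans Mle; rewrite /M /K mulnCA.
apply: le_trans main.
have ec0 := error_const_gt0 d' s hB.
have q0 : 0 < (q ^ (d' * t0))%:R :> R by rewrite ltr0n expn_gt0.
have m0R : 0 < m%:R :> R by rewrite ltr0n.
have lnm0 : 0 <= ln m%:R :> R by rewrite ln_ge0 // ler1n.
have lnm : ln m%:R / ln q'%:R <= t0%:R :> R.
  rewrite ler_pdivrMr // mulr_natl -lnXn ?ltr0n ?(ltnW q'1) //.
  rewrite ler_ln ?posrE ?exprn_gt0 ?ltr0n ?(ltnW q'1) // -natrX ler_nat.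
  apply: leq_trans (up_logP M q'1).
  by rewrite /M leq_pmulr.
have Qm : (q ^ (d' * t0))%:R <= (q' * K)%:R * m%:R :> R.
  by rewrite -natrM ler_nat; apply: leq_trans leM _; rewrite /M [(m * K)%N]mulnC mulnA.
have -> : error_const d' s B * (ln q'%:R ^+ d')^-1 * (q' * K)%:R ^- (2 * s) *
    m%:R ^- (2 * s) * ln m%:R ^+ d' =
  error_const d' s B * (ln m%:R / ln q'%:R) ^+ d' * ((q' * K)%:R * m%:R) ^- (2 * s).
  by rewrite exprMn exprVn [in RHS]exprMn invfM; ring.
apply: ler_pM.
- by rewrite mulr_ge0 ?(ltW ec0) // exprn_ge0 // divr_ge0 // ltW.
- by rewrite invr_ge0 exprn_ge0 // mulr_ge0.
- rewrite ler_wpM2l ?(ltW ec0) // lerXn2r ?nnegrE // divr_ge0 // ltW //.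
rewrite lef_pV2 ?posrE ?exprn_gt0 //; last exact: lt_le_trans q0 Qm.
rewrite lerXn2r ?nnegrE ?(ltW q0) // ltW // (lt_le_trans q0 Qm) //.
Qed.
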